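(* Let $L$ be a positive definite even lattice of rank $\ell$, $p\ge2$ an integer, and $\sigma$ an isometry of $L$ of order $p$ which is fixed-point-free on $L$. Let $\widehat\sigma\in\mathrm{Aut}(V_L)$ be a lift of $\sigma$, and let $V_L^T=M(1)(\sigma)\otimes T$ be the $\widehat\sigma$-twisted $V_L$-module associated with a finite dimensional $\widehat L_\sigma$-module $T$ satisfying $\kappa_s=\xi_s\,\mathrm{id}_T$ and $at=\widehat\sigma(a)t$ for $a\in\widehat L_\sigma$, $t\in T$. Then the quantum dimension $\mathrm{qdim}_{V_L}V_L^T$ exists and $$\mathrm{qdim}_{V_L}V_L^T=\frac{v\,\dim T}{\sqrt{\prod_{d\mid p}d^{m_d}}},$$ where $v=\mathrm{vol}(\mathbb{R}^\ell/L)$ and the integers $m_d$ are defined by $\det(x-\sigma)=\prod_{d\mid p}(x^d-1)^{m_d}$.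
   Context: $V_L$ is the lattice vertex operator algebra of $L$; its character is $Z_{V_L}(\tau)=\Theta_L(\tau)/\eta(\tau)^\ell$ with $\Theta_L(\tau)=\sum_{\alpha\in L}q^{\langle\alpha,\alpha\rangle/2}$, $q=e^{2\pi\sqrt{-1}\tau}$. For a (twisted) $V$-module $M$ the character is $Z_M(\tau)=\mathrm{tr}_M q^{L_0-c_V/24}$, and the quantum dimension is $\mathrm{qdim}_V M=\lim_{y\to0^+}Z_M(\sqrt{-1}y)/Z_V(\sqrt{-1}y)$ when the limit exists. Let $s=p$ if $p$ is even and $s=2p$ if $p$ is odd, $\xi_s$ a primitive $s$-th root of unity, and $c^\sigma(\alpha,\beta)=\frac{s}{p}\sum_{i=1}^{p-1}\langle i\sigma^i(\alpha),\beta\rangle+s\mathbb{Z}$; $\widehat L_\sigma$ is the central extension $1\to\langle\kappa_s\rangle\to\widehat L_\sigma\to L\to1$ by a cyclic group of order $s$ with commutator $aba^{-1}b^{-1}=\kappa_s^{c^\sigma(\bar a,\bar b)}$, on which $\widehat\sigma$ acts as an automorphism lifting $\sigma$. $M(1)(\sigma)$ is the $\sigma$-twisted module of the Heisenberg VOA on $\mathfrak h=\mathbb{C}\otimes L$ (induced from the twisted affine algebra $\bigoplus_{i=1}^{p-1}\mathfrak h^{(i;\sigma)}\otimes t^{i/p}\mathbb{C}[t,t^{-1}]\oplus\mathbb{C}K$, where $\mathfrak h^{(i;\sigma)}=\{u\mid\sigma u=\xi_p^{-i}u\}$, $r_i=\dim\mathfrak h^{(i;\sigma)}$), with character $Z_{M(1)(\sigma)}(\tau)=q^{\rho-\ell/24}\big/\prod_{i=1}^{p-1}\prod_{n\ge0}(1-q^{i/p+n})^{r_{p-i}}$,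 $\rho=\frac{1}{4p^2}\sum_{i=1}^{p-1}i(p-i)r_i$; the $\widehat\sigma$-twisted module $V_L^T=M(1)(\sigma)\otimes T$ has character $\dim T\cdot Z_{M(1)(\sigma)}(\tau)$. *)

(* Defs.v *)
From HB Require Import structures.
From mathcomp Require Import all_boot all_order all_algebra all_field.
From Stdlib Require Import Reals ClassicalEpsilon.

Set Implicit Arguments.
Unset Strict Implicit.
Unset Printing Implicit Defensive.

Import GRing.Theory Num.Theory.

Section Alg.
Local Open Scope ring_scope.

(* The lattice L is Z^l with the bilinear form <a,b> = a^T G b,
   where G : 'M[int]_l is the Gram matrix (column-vector convention). *)

(* "even lattice": integral symmetric form with <a,a> in 2Z for all a,
   i.e. G symmetric with even diagonal; "positive definite" on R (x) L. *)
Definition int_to_Z (z : int) : Z :=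
  match z with Posz n => Z.of_nat n | Negz n => Z.opp (Z.of_nat n.+1) end.

Definition intR (z : int) : R := IZR (int_to_Z z).

Definition Rsum {T : Type} (s : seq T) (f : T -> R) : R :=
  foldr (fun a acc => Rplus (f a) acc) R0 s.

Definition qformR (l : nat) (G : 'M[int]_l) (x : 'I_l -> R) : R :=
  Rsum (enum 'I_l) (fun i => Rsum (enum 'I_l)
     (fun j => Rmult (Rmult (intR (G i j)) (x i)) (x j))).

Definition even_lattice (l : nat) (G : 'M[int]_l) : Prop :=
  G^T = G /\ (forall i : 'I_l, G i i \in dvdz 2).

Definition positive_definite (l : nat) (G : 'M[int]_l) : Prop :=
  forall x : 'I_l -> R, (exists i, x i <> R0) -> Rlt R0 (qformR G x).

Definition is_isometry (l : nat) (G sigma : 'M[int]_l) : Prop :=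
  sigma^T *m G *m sigma = G.

Definition has_order (l : nat) (sigma : 'M[int]_l) (p : nat) : Prop :=
  sigma ^+ p = 1 /\ (forall k : nat, (0 < k < p)%nat -> sigma ^+ k <> 1).

Definition fixed_point_free (l : nat) (sigma : 'M[int]_l) : Prop :=
  forall a : 'cV[int]_l, sigma *m a = a -> a = 0.

(* r_i = dim h^(i;sigma), h^(i;sigma) = { u in C (x) L | sigma u = xi_p^{-i} u }.
   (eigenspace g c is the row space {u | u *m g = c u}; with g = sigma^T this is
   {u | sigma u^T = c u^T}.) *)
Definition rdim (l : nat) (sigma : 'M[int]_l) (xi : algC) (i : nat) : nat :=
  \rank (eigenspace (map_mx intr sigma)^T (xi ^- i)).

Definition posp (z : int) : nat := match z with Posz n => n | Negz _ => 0%N end.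
Definition negp (z : int) : nat := match z with Posz _ => 0%N | Negz n => n.+1 end.

(* det(x - sigma) = prod_{d | p} (x^d - 1)^{m_d}  (m_d in Z), written with
   denominators cleared in the integral domain {poly int}. *)
Definition char_decomposition (l : nat) (sigma : 'M[int]_l) (p : nat)
    (m : nat -> int) : Prop :=
  char_poly sigma * \prod_(d <- divisors p) ('X^d - 1) ^+ negp (m d)
  = \prod_(d <- divisors p) ('X^d - 1) ^+ posp (m d).

Definition detR (l : nat) (G : 'M[int]_l) : R := intR (\det G).

End Alg.

Section Ana.
Local Open Scope R_scope.

(* the limit of a real sequence (meaningful when it converges) *)
Definition seq_lim (u : nat -> R) : R :=
  epsilon (inhabits 0) (fun l => Un_cv u l).

Fixpoint prodR (f : nat -> R) (N : nat) : R :=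
  match N with O => 1 | S k => prodR f k * f k end.

(* q^x at tau = sqrt(-1) y, q = exp(2 pi sqrt(-1) tau) = exp(-2 pi y) *)
Definition qpow (y x : R) : R := exp (- (2 * PI * y * x)).

(* Theta_L(sqrt(-1) y) = sum_{a in L} q^{<a,a>/2}, as the limit of the
   sums over the boxes [-N,N]^l (all terms are positive). *)
Definition theta (l : nat) (G : 'M[int]_l) (y : R) : R :=
  seq_lim (fun N =>
    Rsum (enum [pred k : {ffun 'I_l -> 'I_(2 * N + 1)} | true])
      (fun k => qpow y (qformR G (fun i => INR (k i) - INR N) / 2))).

Definition eta (y : R) : R :=
  qpow y (1/24) * seq_lim (fun N => prodR (fun n => 1 - qpow y (INR (S n))) N).

Definition Z_VL (l : nat) (G : 'M[int]_l) (y : R) : R :=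
  theta G y / (eta y ^ l).

Definition rho (p : nat) (r : nat -> nat) : R :=
  / (4 * INR p ^ 2) *
  Rsum (iota 1 (p - 1)) (fun i => INR i * INR (p - i) * INR (r i)).

Definition Z_M1 (l p : nat) (r : nat -> nat) (y : R) : R :=
  qpow y (rho p r - INR l / 24) /
  prodR (fun j =>
     let i := S j in
     seq_lim (fun N => prodR (fun n =>
        (1 - qpow y (INR i / INR p + INR n)) ^ (r (p - i)%nat)) N)) (p - 1).

Definition Z_VLT (l p : nat) (sigma : 'M[int]_l) (xi : algC) (dimT : nat)
    (y : R) : R :=
  INR dimT * Z_M1 l p (rdim sigma xi) y.

Definition qdim_is (ZM ZV : R -> R) (Q : R) : Prop :=
  forall eps : R, 0 < eps -> exists delta : R, 0 < delta /\
    forall y : R, 0 < y < delta -> Rabs (ZM y / ZV y - Q) < eps.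

Definition prod_dm (p : nat) (m : nat -> int) : R :=
  foldr (fun d acc => powerRZ (INR d) (int_to_Z (m d)) * acc) 1 (divisors p).

End Ana.

(* Main.v *)
(* Let F(h) = ln prod_(n >= 1) (1 - e^(-nh)) and, for a divisor d of p,
     T_d(h) = d F(h) - F(h/d) + (d-1)/2 ln h.
   Each T_d is nonnegative (ln (1 - e^(-x)) is concave) and nondecreasing
   (x / (e^x - 1) is convex), hence has a limit c_d as h -> 0+.  Computing T_(2d)
   in two ways gives c_d = (d-1) (c_2 + ln 2 / 2) - ln d / 2.
   Gauss's product for the triangular-number series writes the one-dimensional
   theta series through T_2, so it is asymptotic to a multiple of t^(-1/2) whose
   constant is e^(c_2); completing squares reduces Theta_L to products of shifted
   one-dimensional sums, each of which is independent of the shift up to O(1).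
   On the module side, the eigenvalue multiplicities of sigma are
   r_a = sum_(d | p, p | a d) m_d with sum m_d = r_0 = 0 and sum d m_d = l, so
   eta^l Z_M(1)(sigma) equals exp (sum_d m_d T_d(h)) h^(-l/2) up to a factor
   tending to 1.  In the quotient the constants e^(c_2) cancel, and neither the
   modularity of eta nor the Gaussian integral is needed. *)

Require Import Defs.
From HB Require Import structures.
From mathcomp Require Import all_boot all_order all_algebra all_field.
From Stdlib Require Import Znat Reals Lra Lia ClassicalEpsilon FunctionalExtensionality.
From Coquelicot Require Import Coquelicot.
From mathcomp Require Import zify Rstruct.

Set Implicit Arguments.
Unset Strict Implicit.
Unset Printing Implicit Defensive.

Import GRing.Theory.

Local Open Scope R_scope.

(** * One-sided limits at 0 and partial sums *)

(** The shape of T_d comes from the expansion of F: its polar term -pi^2/(6h) cancels in d F(h) -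
    F(h/d), which leaves -((d-1)/2) ln h plus a constant. Sign and monotonicity of T_d are obtained
    gap by gap. The points n + (k+1)/d of (n, n+1] are compared with the right end n + 1; such a
    point has weight t_k = 1 - (k+1)/d, the weights of one gap add up to (d-1)/2, and the logarithm
    is spread over the gaps by telescoping ln (1 - e^(-nh)). The gap next to 0 has no finite left
    value, so ln h takes its place, matching x / (e^x - 1) -> 1. The constant c_2 drops out because
    sum m_d = 0 and sum d m_d = l: a term (d-1) u in the limits c_d contributes exactly l u, so the
    module side carries e^(l c_2), the same power as Theta_L. The one-dimensional sums are known
    only up to an additive constant, which the normalization by sqrt t -> 0 absorbs. *)

Lemma seq_lim_eq (u : nat -> R) (L : R) : Un_cv u L -> seq_lim u = L.
Proof.
move=> uL; apply: (UL_sequence u) => //.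
by apply: (epsilon_spec (inhabits 0) (fun l => Un_cv u l)); exists L.
Qed.

Definition lim0 (f : R -> R) (L : R) : Prop :=
  forall eps : R, 0 < eps -> exists delta : R, 0 < delta /\
    forall y : R, 0 < y < delta -> Rabs (f y - L) < eps.

Lemma lim0_ext (f g : R -> R) (L : R) :
  (forall y, 0 < y -> f y = g y) -> lim0 f L -> lim0 g L.
Proof.
move=> fg fL eps e0; have [d [d0 Hd]] := fL eps e0.
by exists d; split=> // y Hy; rewrite -fg; [exact: Hd | lra].
Qed.

Lemma lim0_const (c : R) : lim0 (fun=> c) c.
Proof. by move=> eps e0; exists 1; split; [lra|] => y _; rewrite Rminus_diag Rabs_R0. Qed.

Lemma lim0_plus (f g : R -> R) (L M : R) :
  lim0 f L -> lim0 g M -> lim0 (fun y => f y + g y) (L + M).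
Proof.
move=> fL gM eps e0.
have [d [d0 Hd]] := fL (eps / 2) ltac:(lra).
have [d' [d0' Hd']] := gM (eps / 2) ltac:(lra).
exists (Rmin d d'); split; first exact: Rmin_pos.
move=> y [y0 yd]; have m1 := Rmin_l d d'; have m2 := Rmin_r d d'.
have h1 := Hd y ltac:(lra); have h2 := Hd' y ltac:(lra).
have -> : f y + g y - (L + M) = (f y - L) + (g y - M) by ring.
have := Rabs_triang (f y - L) (g y - M); lra.
Qed.

Lemma lim0_comp (f g : R -> R) (L : R) :
  continuity_pt g L -> lim0 f L -> lim0 (fun y => g (f y)) (g L).
Proof.
move=> gc fL eps e0; have [a [a0 Ha]] := gc eps e0.
have [d [d0 Hd]] := fL a a0.
exists d; split=> // y Hy.
case: (Req_dec (f y) L) => [->|ne]; first by rewrite Rminus_diag Rabs_R0.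
apply: (Ha (f y)); split; last exact: Hd.
by split=> //; exact: not_eq_sym.
Qed.

Lemma lim0_scal (c : R) (f : R -> R) (L : R) :
  lim0 f L -> lim0 (fun y => c * f y) (c * L).
Proof.
apply: (@lim0_comp f (fun x => c * x)).
by apply: continuity_pt_mult; [exact: continuity_pt_const|exact: continuity_pt_id].
Qed.

(** Polarization, 4 L M = (L + M)^2 - (L - M)^2, reduces products to sums and to composition with
    the continuous map x^2. *)
Lemma lim0_mult (f g : R -> R) (L M : R) :
  lim0 f L -> lim0 g M -> lim0 (fun y => f y * g y) (L * M).
Proof.
have sq h H : lim0 h H -> lim0 (fun y => h y ^ 2) (H ^ 2).
  apply: (@lim0_comp h (fun x => x ^ 2)).
  exact/derivable_continuous_pt/derivable_pt_pow.
move=> fL gM.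
have h1 := sq _ _ (lim0_plus fL gM).
have h2 := sq _ _ (lim0_plus fL (lim0_scal (-1) gM)).
have := lim0_scal (1/4) (lim0_plus h1 (lim0_scal (-1) h2)).
have -> : 1 / 4 * ((L + M) ^ 2 + -1 * (L + -1 * M) ^ 2) = L * M by field.
by apply: lim0_ext => y _; field.
Qed.

Lemma lim0_inv (f : R -> R) (L : R) :
  L <> 0 -> lim0 f L -> lim0 (fun y => / f y) (/ L).
Proof.
move=> L0; apply: (@lim0_comp f Rinv).
by apply: (@continuity_pt_inv id L) => //; exact: continuity_pt_id.
Qed.

Lemma lim0_rescale (c : R) (f : R -> R) (L : R) :
  0 < c -> lim0 f L -> lim0 (fun y => f (c * y)) L.
Proof.
move=> c0 fL eps e0; have [d [d0 Hd]] := fL eps e0.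
have dc : c * (d / c) = d by field; lra.
exists (d / c); split; first exact: Rdiv_lt_0_compat.
by move=> y [y0 yd]; apply: Hd; split; [nra | rewrite -dc; nra].
Qed.

Lemma lim0_unique (f : R -> R) (L M : R) : lim0 f L -> lim0 f M -> L = M.
Proof.
move=> fL fM; case: (Req_dec L M) => // ne; exfalso.
have e0 : 0 < Rabs (L - M) / 2 by have := Rabs_pos_lt (L - M); lra.
have [d [d0 Hd]] := fL _ e0; have [d' [d0' Hd']] := fM _ e0.
have m0 := Rmin_pos _ _ d0 d0'.
have m1 := Rmin_l d d'; have m2 := Rmin_r d d'.
have h1 := Hd (Rmin d d' / 2) ltac:(lra).
have h2 := Hd' (Rmin d d' / 2) ltac:(lra).
move: h1; rewrite Rabs_minus_sym => h1.
have := Rabs_triang (L - f (Rmin d d' / 2)) (f (Rmin d d' / 2) - M).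
have -> : L - f (Rmin d d' / 2) + (f (Rmin d d' / 2) - M) = L - M by ring.
lra.
Qed.

Lemma lim0_squeeze (f g h : R -> R) (L : R) :
  (forall y, 0 < y -> f y <= g y <= h y) -> lim0 f L -> lim0 h L -> lim0 g L.
Proof.
move=> fgh fL hL eps e0.
have [d [d0 Hd]] := fL eps e0; have [d' [d0' Hd']] := hL eps e0.
exists (Rmin d d'); split; first exact: Rmin_pos.
move=> y [y0 yd]; have m1 := Rmin_l d d'; have m2 := Rmin_r d d'.
have := Hd y ltac:(lra); have := Hd' y ltac:(lra); have := fgh y y0.
by move=> ? /Rabs_def2 ? /Rabs_def2 ?; apply: Rabs_def1; lra.
Qed.

(** The limit is the infimum of the values, built as minus the least upper bound of [- f]. *)
Lemma lim0_monotone (f : R -> R) (b : R) :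
  (forall x y, 0 < x -> x <= y -> f x <= f y) -> (forall x, 0 < x -> b <= f x) ->
  exists L, lim0 f L.
Proof.
move=> mono lb.
pose E z := exists x, 0 < x /\ z = - f x.
have bE : bound E by exists (- b) => z [x [x0 ->]]; have := lb x x0; lra.
have nE : exists z, E z by exists (- f 1), 1; split; [lra|].
have [M [ubM lubM]] := completeness E bE nE.
exists (- M) => eps e0.
case: (classic (exists x, 0 < x /\ f x < - M + eps)) => [[d [d0 fd]]|no].
  exists d; split=> // y [y0 yd].
  have h1 := mono y d y0 ltac:(lra).
  have h2 : - f y <= M by apply: ubM; exists y.
  by apply: Rabs_def1; lra.
have : M <= M - eps.
  apply: lubM => z [x [x0 ->]].
  by case: (Rle_or_lt (- M + eps) (f x)) => h; [lra | case: no; exists x].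
lra.
Qed.

(** The upper end is excluded, so lengths add and multiply exactly in [psum_add] and [psum_mul]. *)
Fixpoint psum (f : nat -> R) (N : nat) : R :=
  if N is k.+1 then psum f k + f k else 0.

Lemma psum_ext (f g : nat -> R) (N : nat) :
  (forall n, (n < N)%nat -> f n = g n) -> psum f N = psum g N.
Proof.
elim: N => //= N IH fg; congr (_ + _); last exact: fg.
by apply: IH => n nN; exact/fg/ltnW.
Qed.

Lemma psum_le (f g : nat -> R) (N : nat) :
  (forall n, (n < N)%nat -> f n <= g n) -> psum f N <= psum g N.
Proof.
elim: N => /= [|N IH] fg; first lra.
by have := fg N (ltnSn N); have := IH (fun n nN => fg n (ltnW nN)); lra.
Qed.

Lemma psum_recr (f : nat -> R) (N : nat) : psum f N.+1 = psum f N + f N.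
Proof. by []. Qed.

Lemma psum_ge0 (f : nat -> R) (N : nat) : (forall n, 0 <= f n) -> 0 <= psum f N.
Proof. by move=> f0; elim: N => /= [|N IH]; [lra | have := f0 N; lra]. Qed.

Lemma psum_plus (f g : nat -> R) (N : nat) :
  psum (fun n => f n + g n) N = psum f N + psum g N.
Proof. by elim: N => /= [|N ->]; ring. Qed.

Lemma psum_scal (c : R) (f : nat -> R) (N : nat) :
  psum (fun n => c * f n) N = c * psum f N.
Proof. by elim: N => /= [|N ->]; ring. Qed.

Lemma psum_const (c : R) (N : nat) : psum (fun=> c) N = INR N * c.
Proof. by elim: N => [|N IH]; rewrite ?S_INR /= ?IH; ring. Qed.

Lemma psum_telescope (f : nat -> R) (N : nat) :
  psum (fun n => f n.+1 - f n) N = f N - f 0%nat.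
Proof. by elim: N => /= [|N ->]; ring. Qed.

Lemma psum_add (f : nat -> R) (M N : nat) :
  psum f (M + N) = psum f M + psum (fun n => f (M + n)%nat) N.
Proof. by elim: N => [|N IH]; rewrite ?addn0 ?addnS /= ?IH; ring. Qed.

Lemma psum_recl (f : nat -> R) (N : nat) :
  psum f N.+1 = f 0%nat + psum (fun n => f n.+1) N.
Proof. by rewrite -[N.+1]add1n psum_add /= Rplus_0_l. Qed.

Lemma psum_mul (f : nat -> R) (d N : nat) :
  psum f (d * N) = psum (fun n => psum (fun k => f (d * n + k)%nat) d) N.
Proof. by elim: N => [|N IH]; rewrite ?muln0 //= mulnS addnC psum_add IH. Qed.

Lemma psum_rev (f : nat -> R) (N : nat) :
  psum f N = psum (fun n => f (N - n.+1)%nat) N.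
Proof.
elim: N => // N IH; rewrite [RHS]psum_recl subn1 /= IH Rplus_comm.
by congr (_ + _); apply: psum_ext => n nN; congr f; lia.
Qed.

Lemma psum_exchange (f : nat -> nat -> R) (M N : nat) :
  psum (fun m => psum (f m) N) M = psum (fun n => psum (f^~ n) M) N.
Proof.
elim: N => /= [|N <-]; first by rewrite psum_const; ring.
by rewrite psum_plus.
Qed.

Lemma cv_const (c : R) : Un_cv (fun=> c) c.
Proof. by move=> eps e0; exists 0%nat => n _; rewrite /Rdist Rminus_diag Rabs_R0. Qed.

Lemma cv_ext (u v : nat -> R) (L : R) : u =1 v -> Un_cv u L -> Un_cv v L.
Proof. by move=> uv uL eps e0; have [N HN] := uL eps e0; exists N => n; rewrite -uv; apply: HN. Qed.

Lemma cv_scal (c : R) (u : nat -> R) (L : R) :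
  Un_cv u L -> Un_cv (fun n => c * u n) (c * L).
Proof. by move=> uL; apply: CV_mult => //; exact: cv_const. Qed.

Lemma cv_psum (u : nat -> nat -> R) (L : nat -> R) (M : nat) :
  (forall k, (k < M)%nat -> Un_cv (u k) (L k)) ->
  Un_cv (fun N => psum (fun k => u k N) M) (psum L M).
Proof.
elim: M => /= [|M IH] H; first exact: cv_const.
by apply: CV_plus; [apply: IH => k kM; apply/H/ltnW | exact: H].
Qed.

Lemma cv_subseq (u : nat -> R) (L : R) (r : nat -> nat) :
  (forall n, (n <= r n)%nat) -> Un_cv u L -> Un_cv (fun n => u (r n)) L.
Proof.
move=> rn uL eps e0; have [N HN] := uL eps e0; exists N => n nN; apply: HN.
by apply/leP; apply: leq_trans (rn n); apply/leP.
Qed.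

Lemma cv_le (u v : nat -> R) (L M : R) :
  (forall n, u n <= v n) -> Un_cv u L -> Un_cv v M -> L <= M.
Proof. by move=> uv uL vM; apply: (Rle_cv_lim (Un:=u) (Vn:=v)). Qed.

Lemma cv_comp (u : nat -> R) (f : R -> R) (L : R) :
  continuity_pt f L -> Un_cv u L -> Un_cv (fun n => f (u n)) (f L).
Proof. by move=> fc uL; apply: continuity_seq. Qed.

(** * The functions ln (1 - e^(-x)) and x / (e^x - 1) *)

Lemma increment_le (f f' : R -> R) (a b m M : R) : a <= b ->
  (forall x, a <= x <= b -> derivable_pt_lim f x (f' x)) ->
  (forall x, a <= x <= b -> m <= f' x <= M) ->
  m * (b - a) <= f b - f a <= M * (b - a).
Proof.
case=> [ab|->] df bf; last by lra.
by have [c [-> cab]] := MVT_cor2 f f' a b ab df; have := bf c ltac:(lra); nra.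
Qed.

Lemma derive_ge0_le (f f' : R -> R) (a b : R) : a <= b ->
  (forall x, a <= x <= b -> derivable_pt_lim f x (f' x)) ->
  (forall x, a <= x <= b -> 0 <= f' x) -> f a <= f b.
Proof.
case=> [ab|->] df f0; last by lra.
have [c [E cab]] := MVT_cor2 f f' a b ab df.
by have := f0 c ltac:(lra); nra.
Qed.

Lemma expm1_gt0 (x : R) : 0 < x -> 0 < exp x - 1.
Proof. by move=> x0; have := exp_increasing 0 x x0; rewrite exp_0; lra. Qed.

Lemma exp_neg_bounds (x : R) : 0 < x -> 0 < exp (- x) < 1.
Proof.
move=> x0; split; first exact: exp_pos.
by rewrite -exp_0; apply: exp_increasing; lra.
Qed.

Lemma exp_pow_INR (x : R) (k : nat) : exp x ^ k = exp (INR k * x).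
Proof.
elim: k => [|k IH]; first by rewrite /= Rmult_0_l exp_0.
by rewrite S_INR /= IH -exp_plus; congr exp; ring.
Qed.

Definition ln1mexp (x : R) : R := ln (1 - exp (- x)).

Lemma ln1mexp_derive (x : R) : 0 < x -> derivable_pt_lim ln1mexp x (/ (exp x - 1)).
Proof.
move=> x0; apply/is_derive_Reals; rewrite /ln1mexp.
have h := exp_neg_bounds x0; have h1 := expm1_gt0 x0.
auto_derive; first lra.
have p := exp_pos x; move: h; rewrite exp_Ropp => h; field.
by repeat split; lra.
Qed.

Lemma ln1mexp_le0 (x : R) : 0 < x -> ln1mexp x <= 0.
Proof.
by move=> x0; have h := exp_neg_bounds x0; rewrite -ln_1; apply: ln_le; lra.
Qed.

(** With a = e^(-x), -ln (1 - a) <= a / (1 - a), and the denominator is then bounded by its value at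
    c. The result is linear in e^(-x), hence sums as a geometric series along an arithmetic
    progression. *)
Lemma ln1mexp_lower (c x : R) : 0 < c -> c <= x ->
  - (exp (- x) / (1 - exp (- c))) <= ln1mexp x.
Proof.
move=> c0 cx; have h := exp_neg_bounds c0.
have hx := @exp_neg_bounds x ltac:(lra).
have hcx : exp (- x) <= exp (- c) by case: cx => [lt|->]; [apply/Rlt_le/exp_increasing|]; lra.
set a := exp (- x) in hx hcx *; set b := exp (- c) in h hcx *.
have -> : ln1mexp x = - ln (/ (1 - a)) by rewrite ln_Rinv; [rewrite /ln1mexp -/a; ring | lra].
have i0 : 0 < / (1 - a) by apply: Rinv_0_lt_compat; lra.
have : ln (/ (1 - a)) <= / (1 - a) - 1.
  by have := exp_ineq1_le (ln (/ (1 - a))); rewrite exp_ln //; lra.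
have -> : / (1 - a) - 1 = a / (1 - a) by field; lra.
have : a / (1 - a) <= a / (1 - b).
  by apply: Rmult_le_compat_l; [lra | apply: Rinv_le_contravar; lra].
lra.
Qed.

Lemma ln1mexp_le_ln (x : R) : 0 < x -> ln1mexp x <= ln x.
Proof.
move=> x0; have h := exp_neg_bounds x0; apply: ln_le; first lra.
by have := exp_ineq1_le (- x); lra.
Qed.

Lemma ln1mexp_increment (a b : R) : 0 < a -> a <= b ->
  (b - a) / (exp b - 1) <= ln1mexp b - ln1mexp a <= (b - a) / (exp a - 1).
Proof.
move=> a0 ab; rewrite ![(b - a) / _]Rmult_comm.
apply: (@increment_le _ (fun x => / (exp x - 1))) => // x xab.
  by apply: ln1mexp_derive; lra.
have inc u v : 0 < u -> u <= v -> / (exp v - 1) <= / (exp u - 1).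
  move=> u0 uv; have := expm1_gt0 u0 => ?; apply: Rinv_le_contravar => //.
  by case: uv => [/exp_increasing|->]; lra.
by split; apply: inc; lra.
Qed.

(** Both increments are compared with the derivative 1 / (e^b - 1) at their common point b. *)
Lemma ln1mexp_concave (b h t : R) : 0 < b - t * h -> 0 < h -> 0 <= t <= 1 ->
  t * (ln1mexp (b + h) - ln1mexp b) <= ln1mexp b - ln1mexp (b - t * h).
Proof.
move=> bh h0 t01.
have h1 := @ln1mexp_increment (b - t * h) b ltac:(nra) ltac:(nra).
have h2 := @ln1mexp_increment b (b + h) ltac:(nra) ltac:(nra).
have E1 : b - (b - t * h) = t * h by ring.
have E2 : b + h - b = h by ring.
rewrite E1 in h1; rewrite E2 in h2.
have : (t * h) / (exp b - 1) = t * (h / (exp b - 1)) by rewrite /Rdiv; ring.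
nra.
Qed.

(** The generating function of the Bernoulli numbers. It enters through h d/dh ln (1 - e^(-ch)) = ch
    / (e^(ch) - 1): monotonicity in h becomes an inequality between values of [bern]. *)
Definition bern (x : R) : R := x / (exp x - 1).
Definition bern' (x : R) : R := (exp x - 1 - x * exp x) / (exp x - 1) ^ 2.

Lemma bern_derive (x : R) : 0 < x -> derivable_pt_lim bern x (bern' x).
Proof.
move=> x0; apply/is_derive_Reals; rewrite /bern /bern'; have := expm1_gt0 x0 => h.
by auto_derive; [lra | field; lra].
Qed.

Lemma bern'_derive (x : R) : 0 < x ->
  derivable_pt_lim bern' x (exp x * ((x - 2) * exp x + x + 2) / (exp x - 1) ^ 3).
Proof.
move=> x0; apply/is_derive_Reals; rewrite /bern'; have := expm1_gt0 x0 => h.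
by auto_derive; [have := pow_lt _ 2 h => /=; lra | field; lra].
Qed.

(** The expression vanishes at 0 together with its derivative (x - 1) e^x + 1, and its second
    derivative is x e^x. *)
Lemma bern'_num_ge0 (x : R) : 0 <= x -> 0 <= (x - 2) * exp x + x + 2.
Proof.
move=> x0.
have k1 y : 0 <= y -> 0 <= (y - 1) * exp y + 1.
  move=> y0; have -> : 0 = (0 - 1) * exp 0 + 1 by rewrite exp_0; ring.
  apply: (@derive_ge0_le (fun y => (y - 1) * exp y + 1) (fun y => y * exp y)) => // z hz.
    by apply/is_derive_Reals; auto_derive => //; ring.
  by apply: Rmult_le_pos; [lra | apply/Rlt_le/exp_pos].
have -> : 0 = (0 - 2) * exp 0 + 0 + 2 by rewrite exp_0; ring.
apply: (@derive_ge0_le (fun x => (x - 2) * exp x + x + 2)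
  (fun y => (y - 1) * exp y + 1)) => // z hz.
  by apply/is_derive_Reals; auto_derive => //; ring.
by apply: k1; lra.
Qed.

Lemma bern'_monotone (a b : R) : 0 < a -> a <= b -> bern' a <= bern' b.
Proof.
move=> a0 ab; apply: (derive_ge0_le ab) => x xab; first by apply: bern'_derive; lra.
have x0 : 0 < x by lra.
apply: Rmult_le_pos; last by apply/Rlt_le/Rinv_0_lt_compat/pow_lt/expm1_gt0.
by apply: Rmult_le_pos; [apply/Rlt_le/exp_pos | apply: bern'_num_ge0; lra].
Qed.

Lemma bern_convex (b h t : R) : 0 < h -> 0 < b - h -> 0 <= t <= 1 ->
  bern (b - t * h) <= (1 - t) * bern b + t * bern (b - h).
Proof.
move=> h0 bh t01.
have [|h1 _] := @increment_le bern bern' (b - t * h) b (bern' (b - t * h)) (bern' b)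
  ltac:(nra) (fun x _ => @bern_derive x ltac:(nra)).
  by move=> x ?; split; apply: bern'_monotone; nra.
have [|_ h2] := @increment_le bern bern' (b - h) (b - t * h) (bern' (b - h)) (bern' (b - t * h))
  ltac:(nra) (fun x _ => @bern_derive x ltac:(nra)).
  by move=> x ?; split; apply: bern'_monotone; nra.
nra.
Qed.

(** The square of x <= 2 sinh (x/2), multiplied by e^x; the difference there has derivative cosh
    (x/2) - 1, a square over a positive number. *)
Lemma sqr_mul_exp_le (x : R) : 0 <= x -> x ^ 2 * exp x <= (exp x - 1) ^ 2.
Proof.
move=> x0.
have k1 : 0 <= exp (x / 2) - exp (- (x / 2)) - x.
  have -> : 0 = exp (0 / 2) - exp (- (0 / 2)) - 0.
    by rewrite /Rdiv Rmult_0_l Ropp_0; ring.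
  apply: (@derive_ge0_le (fun x => exp (x / 2) - exp (- (x / 2)) - x)
    (fun x => (exp (x / 2) + exp (- (x / 2))) / 2 - 1)) => // z hz.
    by apply/is_derive_Reals; auto_derive => //; rewrite /Rdiv; field.
  rewrite exp_Ropp; have p := exp_pos (z / 2).
  set e := exp (z / 2) in p *.
  have -> : (e + / e) / 2 - 1 = (e - 1) ^ 2 * / (2 * e) by field; lra.
  apply: Rmult_le_pos; first exact: pow2_ge_0.
  by apply/Rlt_le/Rinv_0_lt_compat; lra.
have -> : exp x = exp (x / 2) ^ 2 by rewrite /= Rmult_1_r -exp_plus; congr exp; field.
have p := exp_pos (x / 2); move: k1; rewrite exp_Ropp.
set e := exp (x / 2) in p * => k1.
have : x * e <= e ^ 2 - 1.
  have -> : e ^ 2 - 1 = e * (e - / e) by field; lra.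
  nra.
move=> h; have -> : x ^ 2 * e ^ 2 = (x * e) ^ 2 by ring.
by apply: pow_incr; split=> //; nra.
Qed.

(** Convexity with one end at 0, where the limit value is 1 but [bern 0] evaluates to 0. Hence the
    chord slope (bern x - 1) / x = 1/(e^x - 1) - 1/x is shown to be nondecreasing instead. *)
Lemma bern_secant (h u : R) : 0 < h -> 0 < u <= 1 -> bern (u * h) - 1 <= u * (bern h - 1).
Proof.
move=> h0 [u0 u1].
have slope : / (exp (u * h) - 1) - / (u * h) <= / (exp h - 1) - / h.
  apply: (@derive_ge0_le (fun x => / (exp x - 1) - / x)
    (fun x => / x ^ 2 - exp x / (exp x - 1) ^ 2) (u * h) h) => [|x hx|x hx]; first nra.
    apply/is_derive_Reals; have x0 : 0 < x by nra.
    have := expm1_gt0 x0 => e0; auto_derive; first by repeat split; lra.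
    by field; lra.
  have x0 : 0 < x by nra.
  have e0 := expm1_gt0 x0; have := @sqr_mul_exp_le x ltac:(lra) => h1.
  have x2 := pow_lt _ 2 x0; have e2 := pow_lt _ 2 e0.
  have -> : / x ^ 2 - exp x / (exp x - 1) ^ 2
    = ((exp x - 1) ^ 2 - x ^ 2 * exp x) * / (x ^ 2 * (exp x - 1) ^ 2) by field; lra.
  apply: Rmult_le_pos; first lra.
  by apply/Rlt_le/Rinv_0_lt_compat; nra.
have E x : 0 < x -> bern x - 1 = x * (/ (exp x - 1) - / x).
  by move=> x0; have := expm1_gt0 x0 => ?; rewrite /bern; field; lra.
have uh : 0 < u * h by nra.
by rewrite !E // Rmult_assoc; nra.
Qed.

(** * Infinite products and the multiplication defect *)

Lemma cv_psum_bounded (f : nat -> R) (b : R) :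
  (forall n, 0 <= f n) -> (forall N, psum f N <= b) -> exists L, Un_cv (psum f) L.
Proof.
move=> f0 fb.
have gr : Un_growing (psum f) by move=> n /=; have := f0 n; lra.
have ub : has_ub (psum f) by exists b => _ [n ->].
by have [L HL] := growing_cv _ gr ub; exists L.
Qed.

Lemma psum_geom_le (q : R) (N : nat) : 0 <= q < 1 -> psum (pow q) N <= / (1 - q).
Proof.
move=> [q0 q1]; have E : psum (pow q) N * (1 - q) = 1 - q ^ N.
  by elim: N => [|N IH] /=; [ring | rewrite Rmult_plus_distr_r IH; ring].
have := pow_le q N q0 => qN; apply: (Rmult_le_reg_r (1 - q)); first lra.
by rewrite E Rinv_l; lra.
Qed.

Lemma cv_psum_term (f : nat -> R) (L : R) : Un_cv (psum f) L -> Un_cv f 0.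
Proof.
move=> fL; have -> : 0 = L - L by ring.
apply: (@cv_ext (fun n => psum f n.+1 - psum f n)); first by move=> n /=; ring.
by apply: CV_minus => //; apply: (@cv_subseq _ _ S).
Qed.

(* [lnpoch c h] is the logarithm of the infinite product
   prod_(n >= 0) (1 - e^(-(c+n)h)). *)
Definition lnpoch (c h : R) : R := seq_lim (psum (fun n => ln1mexp ((c + INR n) * h))).

Lemma lnpoch_cv (c h : R) : 0 < c -> 0 < h ->
  Un_cv (psum (fun n => ln1mexp ((c + INR n) * h))) (lnpoch c h).
Proof.
move=> c0 h0; suff [L HL] : exists L, Un_cv (psum (fun n => ln1mexp ((c + INR n) * h))) L.
  by rewrite /lnpoch (seq_lim_eq HL).
have ch0 : 0 < c * h by nra.
have hch := exp_neg_bounds ch0; have hh := exp_neg_bounds h0.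
have pos n : c * h <= (c + INR n) * h by have := pos_INR n; nra.
(* All logarithms are <= 0, so the sign is flipped to get a growing sequence, bounded by a geometric
   series of ratio e^(-h). *)
have [||L HL] := @cv_psum_bounded (fun n => -1 * ln1mexp ((c + INR n) * h))
  (exp (- (c * h)) / (1 - exp (- (c * h))) * / (1 - exp (- h))).
- by move=> n; have := @ln1mexp_le0 _ (Rlt_le_trans _ _ _ ch0 (pos n)); lra.
- move=> N; have h1 := @psum_geom_le (exp (- h)) N ltac:(lra).
  apply: Rle_trans (Rmult_le_compat_l (exp (- (c * h)) / (1 - exp (- (c * h)))) _ _ _ h1).
    rewrite -psum_scal; apply: psum_le => n _.
    have := @ln1mexp_lower (c * h) _ ch0 (pos n).
    have -> : exp (- ((c + INR n) * h)) = exp (- (c * h)) * exp (- h) ^ n.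
      by rewrite exp_pow_INR -exp_plus; congr exp; ring.
    by rewrite /Rdiv; lra.
  by apply/Rlt_le/Rdiv_lt_0_compat; lra.
exists (-1 * L); apply: (cv_ext _ (cv_scal (-1) HL)) => N.
by rewrite psum_scal; ring.
Qed.

Lemma INR_gt0 (d : nat) : (0 < d)%nat -> 0 < INR d.
Proof. by move=> d0; apply/lt_0_INR/ltP. Qed.

(** The numbers n + (k+1)/d with 0 <= k < d are the positive multiples (dn + k + 1)/d of 1/d, each
    met once; regrouping gives the partial sums of length dN. *)
Lemma psum_lnpoch (d : nat) (h : R) : (0 < d)%nat -> 0 < h ->
  psum (fun k => lnpoch (INR k.+1 / INR d) h) d = lnpoch 1 (h / INR d).
Proof.
move=> d0 h0; have D0 := INR_gt0 d0.
have kd k : 0 < INR k.+1 / INR d by apply: Rdiv_lt_0_compat => //; exact: INR_gt0.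
have h1 := cv_psum (fun k (_ : (k < d)%nat) => lnpoch_cv (kd k) h0).
have h2 := @lnpoch_cv 1 (h / INR d) ltac:(lra) (Rdiv_lt_0_compat _ _ h0 D0).
have h3 := @cv_subseq _ _ (muln d) (fun n => leq_pmull n d0) h2.
apply: UL_sequence h1 (cv_ext _ h3) => N.
rewrite psum_mul psum_exchange; apply: psum_ext => n _; apply: psum_ext => k _.
by rewrite plus_INR mult_INR S_INR; congr ln1mexp; field; lra.
Qed.

(** This is T_d, with [lnpoch 1] as F. *)
Definition defect (d : nat) (h : R) : R :=
  INR d * lnpoch 1 h - lnpoch 1 (h / INR d) + (INR d - 1) / 2 * ln h.

(** Each point n + (k+1)/d is paired with the right end n + 1 of its gap, so that the difference can
    be estimated one term at a time. *)
Lemma defect_cv (d : nat) (h : R) : (0 < d)%nat -> 0 < h ->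
  Un_cv (fun N => psum (fun n => psum (fun k => ln1mexp ((1 + INR n) * h)
    - ln1mexp ((INR k.+1 / INR d + INR n) * h)) d) N)
  (INR d * lnpoch 1 h - lnpoch 1 (h / INR d)).
Proof.
move=> d0 h0.
have kd k : 0 < INR k.+1 / INR d by apply: Rdiv_lt_0_compat => //; exact: INR_gt0.
have h1 := cv_psum (fun k (_ : (k < d)%nat) => lnpoch_cv (kd k) h0).
have h2 := cv_scal (INR d) (@lnpoch_cv 1 h ltac:(lra) h0).
rewrite -psum_lnpoch //; apply: (cv_ext _ (CV_minus _ _ _ _ h2 h1)) => N.
rewrite psum_exchange -psum_scal.
have -> (x y : R) : x - y = x + -1 * y by ring.
rewrite -psum_scal -psum_plus; apply: psum_ext => n _.
rewrite -psum_const -psum_scal -psum_plus; apply: psum_ext => k _; ring.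
Qed.

Lemma psum_weights (d : nat) : (0 < d)%nat ->
  psum (fun k => 1 - INR k.+1 / INR d) d = (INR d - 1) / 2.
Proof.
move=> d0; have D0 := INR_gt0 d0.
have E N : psum (fun k => INR k.+1) N = INR N * (INR N + 1) / 2.
  elim: N => [|N IH]; first by rewrite /=; field.
    by rewrite -[psum _ _]/(psum (fun k => INR k.+1) N + INR N.+1) IH S_INR; field.
have -> : psum (fun k => 1 - INR k.+1 / INR d) d
  = psum (fun k => 1 + - / INR d * INR k.+1) d.
  by apply: psum_ext => k _; rewrite /Rdiv; ring.
by rewrite psum_plus psum_scal psum_const E; field; lra.
Qed.

Lemma weight_bounds (d k : nat) : (k < d)%nat -> 0 <= 1 - INR k.+1 / INR d < 1.
Proof.
move=> kd; have D0 := INR_gt0 (leq_trans (ltn0Sn k) kd).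
have K0 : 0 < INR k.+1 / INR d by apply: Rdiv_lt_0_compat => //; exact: INR_gt0.
suff : INR k.+1 / INR d <= 1 by lra.
by apply/(Rdiv_le_1 _ _ D0); apply: le_INR; apply/leP.
Qed.

Lemma ln1mexp_cv0 (h : R) : 0 < h -> Un_cv (fun n => ln1mexp ((1 + INR n) * h)) 0.
Proof. by move=> h0; apply: cv_psum_term (lnpoch_cv Rlt_0_1 h0). Qed.

(** By concavity, the increment over the last stretch t h before (n+1)h is at least t times the next
    full increment. Summed over k and n, these telescope to ((d-1)/2) (0 - ln (1 - e^(-h))), and ln
    (1 - e^(-h)) <= ln h concludes. *)
Lemma defect_ge0 (d : nat) (h : R) : (0 < d)%nat -> 0 < h -> 0 <= defect d h.
Proof.
move=> d0 h0; have D1 : 1 <= INR d by apply: (le_INR 1); apply/leP.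
have lower N : (INR d - 1) / 2 * (ln1mexp ((1 + INR N) * h) - ln1mexp h)
    <= psum (fun n => psum (fun k => ln1mexp ((1 + INR n) * h)
    - ln1mexp ((INR k.+1 / INR d + INR n) * h)) d) N.
  have -> : ln1mexp h = ln1mexp ((1 + INR 0) * h) by rewrite Rplus_0_r Rmult_1_l.
  rewrite -(psum_telescope (fun n => ln1mexp ((1 + INR n) * h))) -psum_scal.
  apply: psum_le => n _; rewrite -psum_weights // Rmult_comm -psum_scal.
  apply: psum_le => k kd; have t01 := weight_bounds kd.
  have n0 := pos_INR n.
  rewrite S_INR.
  have z0 : 0 < (INR k.+1 / INR d + INR n) * h.
    apply: Rmult_lt_0_compat => //.
    by have := Rdiv_lt_0_compat _ _ (INR_gt0 (ltn0Sn k)) (INR_gt0 d0); lra.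
  set t := 1 - INR k.+1 / INR d in t01 *.
  have E1 : (INR k.+1 / INR d + INR n) * h = (1 + INR n) * h - t * h by rewrite /t; ring.
  have E2 : (1 + (INR n + 1)) * h = (1 + INR n) * h + h by ring.
  rewrite E1 in z0 *; rewrite E2 Rmult_comm.
  by apply: ln1mexp_concave => //; lra.
have c1 : Un_cv (fun N => (INR d - 1) / 2 * (ln1mexp ((1 + INR N) * h) - ln1mexp h))
  ((INR d - 1) / 2 * (0 - ln1mexp h)).
  by apply/cv_scal/CV_minus; [exact: ln1mexp_cv0 | exact: cv_const].
have := cv_le lower c1 (defect_cv d0 h0).
by have := ln1mexp_le_ln h0; rewrite /defect; nra.
Qed.

Lemma is_derive_ln1mexp (x : R) : 0 < x -> is_derive ln1mexp x (/ (exp x - 1)).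
Proof. by move=> x0; apply/is_derive_Reals/ln1mexp_derive. Qed.

(** The gap next to 0, with [ln h] in place of the infinite value at the left end. Its derivative
    1/h acts as the value 1 of x / (e^x - 1) at 0, so the sign is that of [bern_secant]. *)
Lemma first_gap_monotone (t x y : R) : 0 <= t < 1 -> 0 < x -> x <= y ->
  let f h := ln1mexp h - ln1mexp ((1 - t) * h) + t * (ln h - ln1mexp h) in f x <= f y.
Proof.
move=> t01 x0 xy f.
apply: (@derive_ge0_le f (fun h => (bern h + t * (1 - bern h) - bern ((1 - t) * h)) / h)) => //.
  move=> h hx; have h0 : 0 < h by lra.
  have th0 : 0 < (1 - t) * h by nra.
  have d1 := is_derive_ln1mexp h0; have d2 := is_derive_ln1mexp th0.
  apply/is_derive_Reals; rewrite /f; auto_derive.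
    by repeat split; first [lra | eexists; exact: d1 | eexists; exact: d2].
  rewrite (is_derive_unique _ _ _ d1) (is_derive_unique _ _ _ d2).
  have e1 := expm1_gt0 h0; have e2 := expm1_gt0 th0.
  by rewrite /bern; field; lra.
move=> h hx; apply: Rmult_le_pos; last by apply/Rlt_le/Rinv_0_lt_compat; lra.
by have := @bern_secant h (1 - t) ltac:(lra) ltac:(lra); lra.
Qed.

(** Times h, the derivative is the chord of [bern] over [(b-1)h, bh], evaluated at (b-t)h, minus
    [bern] there. *)
Lemma later_gap_monotone (b t x y : R) : 1 < b -> 0 <= t < 1 -> 0 < x -> x <= y ->
  let f h := ln1mexp (b * h) - ln1mexp ((b - t) * h)
    + t * (ln1mexp ((b - 1) * h) - ln1mexp (b * h)) in f x <= f y.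
Proof.
move=> b1 t01 x0 xy f.
apply: (@derive_ge0_le f (fun h => (bern (b * h) + t * (bern ((b - 1) * h) - bern (b * h))
  - bern ((b - t) * h)) / h)) => //.
  move=> h hx; have h0 : 0 < h by lra.
  have p1 : 0 < b * h by nra.
  have p2 : 0 < (b - t) * h by nra.
  have p3 : 0 < (b - 1) * h by nra.
  have d1 := is_derive_ln1mexp p1; have d2 := is_derive_ln1mexp p2.
  have d3 := is_derive_ln1mexp p3.
  apply/is_derive_Reals; rewrite /f; auto_derive.
    by repeat split; first [eexists; exact: d1 | eexists; exact: d2 | eexists; exact: d3].
  rewrite (is_derive_unique _ _ _ d1) (is_derive_unique _ _ _ d2) (is_derive_unique _ _ _ d3).
  have e1 := expm1_gt0 p1; have e2 := expm1_gt0 p2; have e3 := expm1_gt0 p3.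
  by rewrite /bern; field; lra.
move=> h hx; apply: Rmult_le_pos; last by apply/Rlt_le/Rinv_0_lt_compat; lra.
have := @bern_convex (b * h) h t ltac:(lra) ltac:(nra) ltac:(lra).
have -> : b * h - t * h = (b - t) * h by ring.
have -> : b * h - h = (b - 1) * h by ring.
lra.
Qed.

(** With L_n = ln (1 - e^(-nh)), ln h = (ln h - L_1) + sum_(n <= N) (L_n - L_(n+1)) + L_(N+1). Each
    difference goes to one gap; [part N] omits the remainder L_(N+1), which tends to 0 as N
    grows. *)
Lemma defect_monotone (d : nat) (x y : R) : (0 < d)%nat -> 0 < x -> x <= y ->
  defect d x <= defect d y.
Proof.
move=> d0 x0 xy; have D1 : 1 <= INR d by apply: (le_INR 1); apply/leP.
pose gap n h := psum (fun k => ln1mexp ((1 + INR n) * h)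
    - ln1mexp ((INR k.+1 / INR d + INR n) * h)) d.
pose part N h := psum (gap^~ h) N.+1 + (INR d - 1) / 2 * (ln h - ln1mexp ((1 + INR N) * h)).
have le_part N : part N x <= part N y.
  elim: N => [|N IH]; rewrite /part.
    rewrite -![psum _ 1]/(0 + _) /gap -[INR 0]/0 !Rplus_0_l !Rplus_0_r !Rmult_1_l.
    rewrite -psum_weights // ![psum _ _ * _]Rmult_comm.
    rewrite -!psum_scal -!psum_plus; apply: psum_le => k kd; rewrite !Rplus_0_r.
    have := @first_gap_monotone _ x y (weight_bounds kd) x0 xy.
    have -> : 1 - (1 - INR k.+1 / INR d) = INR k.+1 / INR d by ring.
    lra.
  have step : gap N.+1 x + (INR d - 1) / 2 * (ln1mexp ((1 + INR N) * x) - ln1mexp ((1 + INR N.+1) * x))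
      <= gap N.+1 y + (INR d - 1) / 2 * (ln1mexp ((1 + INR N) * y) - ln1mexp ((1 + INR N.+1) * y)).
    rewrite /gap -psum_weights // ![psum _ _ * _]Rmult_comm -!psum_scal -!psum_plus.
    apply: psum_le => k kd; have N1 := INR_gt0 (ltn0Sn N).
    have := @later_gap_monotone (1 + INR N.+1) _ x y ltac:(lra) (weight_bounds kd) x0 xy.
    have -> : 1 + INR N.+1 - (1 - INR k.+1 / INR d) = INR k.+1 / INR d + INR N.+1 by ring.
    have -> : 1 + INR N.+1 - 1 = 1 + INR N by rewrite S_INR; ring.
    by move=> /=; lra.
  have E h : psum (gap^~ h) N.+2 = psum (gap^~ h) N.+1 + gap N.+1 h by [].
  by move: IH; rewrite !E /part; lra.
have part_cv h : 0 < h -> Un_cv (part^~ h) (defect d h).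
  move=> h0; rewrite /defect /part.
  have -> : (INR d - 1) / 2 * ln h = (INR d - 1) / 2 * (ln h - 0) by ring.
  apply: CV_plus; first exact: (@cv_subseq _ _ S) (defect_cv d0 h0).
  by apply/cv_scal/CV_minus; [exact: cv_const | exact: ln1mexp_cv0].
exact: cv_le le_part (part_cv x x0) (part_cv y ltac:(lra)).
Qed.

Lemma defect_lim_ex (d : nat) : (0 < d)%nat -> exists c, lim0 (defect d) c.
Proof.
move=> d0; apply: (@lim0_monotone _ 0) => x; first by move=> y; apply: defect_monotone.
exact: defect_ge0.
Qed.

(* Evaluating the defect of [a * b] in both orders forces the shape of the limits. *)
Lemma defect_mul (a b : nat) (h : R) : (0 < a)%nat -> (0 < b)%nat -> 0 < h ->
  defect (a * b) h
  = INR a * defect b h + defect a (h / INR b) + (INR a - 1) / 2 * ln (INR b).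
Proof.
move=> a0 b0 h0; have A0 := INR_gt0 a0; have B0 := INR_gt0 b0.
have -> : defect a (h / INR b) = INR a * lnpoch 1 (h / INR b) - lnpoch 1 (h / INR (a * b)%nat)
    + (INR a - 1) / 2 * (ln h - ln (INR b)).
  rewrite /defect ln_div // mult_INR.
  by have -> : h / INR b / INR a = h / (INR a * INR b) by field; lra.
by rewrite /defect mult_INR; field.
Qed.

Lemma defect_lim (d : nat) (c2 : R) : (0 < d)%nat -> lim0 (defect 2) c2 ->
  lim0 (defect d) ((INR d - 1) * (c2 + ln 2 / 2) - ln (INR d) / 2).
Proof.
move=> d0 l2; have [c lc] := defect_lim_ex d0; have D0 := INR_gt0 d0.
have resc b f L : (0 < b)%nat -> lim0 f L -> lim0 (fun h => f (h / INR b)) L.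
  move=> b0 fL; apply: (lim0_ext _ (lim0_rescale (Rinv_0_lt_compat _ (INR_gt0 b0)) fL)).
  by move=> y _; rewrite /Rdiv Rmult_comm.
have e1 := lim0_plus (lim0_plus (lim0_scal (INR d) l2) (resc 2%nat _ _ isT lc))
   (lim0_const ((INR d - 1) / 2 * ln (INR 2))).
have e2 := lim0_plus (lim0_plus (lim0_scal (INR 2) lc) (resc d _ _ d0 l2))
   (lim0_const ((INR 2 - 1) / 2 * ln (INR d))).
have e1' : lim0 (defect (d * 2)) (INR d * c2 + c + (INR d - 1) / 2 * ln (INR 2)).
  by apply: (lim0_ext _ e1) => h h0; rewrite defect_mul.
have e2' : lim0 (defect (d * 2)) (INR 2 * c + c2 + (INR 2 - 1) / 2 * ln (INR d)).
  by apply: (lim0_ext _ e2) => h h0; rewrite [(d * 2)%nat]mulnC defect_mul.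
have := lim0_unique e1' e2'; have -> : INR 2 = 2 by rewrite /=; ring.
(* The two evaluations read d c2 + c + ((d-1)/2) ln 2 = 2 c + c2 + (1/2) ln d, a linear equation for
   c. *)
by move=> E; have <- : c = (INR d - 1) * (c2 + ln 2 / 2) - ln (INR d) / 2 by lra.
Qed.

(** * Gauss's product for the triangular-number series *)

Lemma cv_squeeze (u v w : nat -> R) (L : R) :
  (forall n, u n <= v n <= w n) -> Un_cv u L -> Un_cv w L -> Un_cv v L.
Proof.
move=> uvw uL wL eps e0; have [N HN] := uL eps e0; have [M HM] := wL eps e0.
exists (N + M)%nat => n nNM; have := HN n ltac:(lia); have := HM n ltac:(lia).
by have := uvw n; rewrite /Rdist => ? /Rabs_def2 ? /Rabs_def2 ?; apply: Rabs_def1; lra.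
Qed.

Lemma cv_pow0 (q : R) : 0 <= q < 1 -> Un_cv (pow q) 0.
Proof.
move=> q01; have [|L] := cv_psum_bounded _ (fun N => psum_geom_le N q01).
  by move=> n; apply: pow_le; lra.
exact: cv_psum_term.
Qed.

(** The partial product prod_(j=1..n) (1 - x^(2j)) / (1 - x^(2j-1)). The powers are spelled through
    x^k so that [field] can treat x^k as an atom. *)
Fixpoint evenodd (x : R) (n : nat) : R :=
  if n is k.+1 then evenodd x k * ((1 - x ^ k * x ^ k * x * x) / (1 - x ^ k * x ^ k * x)) else 1.

Lemma pow_bounds (x : R) (k : nat) : 0 < x < 1 -> 0 < x ^ k <= 1.
Proof. by move=> x01; split; [apply: pow_lt; lra | rewrite -(pow1 k); apply: pow_incr; lra]. Qed.

Lemma evenodd_ge1 (x : R) (n : nat) : 0 < x < 1 -> 1 <= evenodd x n.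
Proof.
move=> x01; elim: n => /= [|n IH]; first lra.
have b := pow_bounds n x01; set c := x ^ n in b *.
have c2 : 0 < c * c <= 1 by nra.
have c2x : 0 < c * c * x < 1 by nra.
have : 0 <= c * c * x * (1 - x) / (1 - c * c * x) by apply: Rdiv_le_0_compat; nra.
have -> : (1 - c * c * x * x) / (1 - c * c * x) = 1 + c * c * x * (1 - x) / (1 - c * c * x).
  by field; lra.
nra.
Qed.

(** At m = n this is the change of the sum in [shanks] from n to n + 1, apart from its new last
    term. The closed form for every m <= n is the certificate that lets induction on m reduce the
    claim to a rational identity. *)
Lemma shanks_telescope (x : R) (n m : nat) : 0 < x < 1 -> (m <= n)%nat ->
  psum (fun s => evenodd x n.+1 / evenodd x s * (x ^ s) ^ (2 * n + 3)
     - evenodd x n / evenodd x s * (x ^ s) ^ (2 * n + 1)) m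
  = evenodd x n / evenodd x m * (x ^ m) ^ (2 * n + 1)
      * (1 - x ^ m * x ^ m) / (1 - x ^ n * x ^ n * x).
Proof.
move=> x01; elim: m => [|m IH] mn; first by rewrite /= /Rdiv; ring.
rewrite [LHS]/= -/(evenodd x n.+1) IH; last exact: ltnW.
have E : (x ^ m.+1) ^ (2 * n + 1) = (x ^ m) ^ (2 * n + 1) * (x ^ n * x ^ n * x).
  by rewrite /= Rpow_mult_distr (_ : (2 * n + 1)%nat = (n + (n + 1))%nat) ?pow_add; [ring | lia].
have E3 : (x ^ m) ^ (2 * n + 3) = (x ^ m) ^ (2 * n + 1) * (x ^ m * x ^ m).
  by rewrite (_ : (2 * n + 3)%nat = ((2 * n + 1) + 2)%nat) ?pow_add /=; [ring | lia].
rewrite E E3 /=.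
have e1 := evenodd_ge1 m x01; have e2 := evenodd_ge1 n x01.
set A := (x ^ m) ^ (2 * n + 1); set b := x ^ m; set c := x ^ n.
have bb : 0 < b <= 1 := pow_bounds m x01; have cb : 0 < c <= 1 := pow_bounds n x01.
have b2 : 0 < b * b <= 1 by nra.
have c2 : 0 < c * c <= 1 by nra.
have c2x : 0 < c * c * x < 1 by nra.
have b2x : 0 < b * b * x < 1 by nra.
have b2xx : 0 < b * b * x * x < 1 by nra.
by field; repeat split; nra.
Qed.

(* D. Shanks, Two theorems of Gauss, Pacific J. Math. 8 (1958): a finite form of
   sum x^(n(n+1)/2) = prod (1 - x^(2n)) / (1 - x^(2n-1)), here with x = e^(-2s). *)
Lemma shanks (s : R) (n : nat) : 0 < s ->
  psum (fun k => evenodd (exp (- (2 * s))) n / evenodd (exp (- (2 * s))) k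
     * (exp (- (2 * s)) ^ k) ^ (2 * n + 1)) n
  = psum (fun k => exp (- (s * (INR k * (INR k + 1))))) (2 * n).
Proof.
move=> s0; have x01 := @exp_neg_bounds (2 * s) ltac:(lra).
have ex k : exp (- (2 * s)) ^ k = exp (- (2 * s * INR k)).
  by rewrite exp_pow_INR; congr exp; ring.
set x := exp (- (2 * s)) in x01 ex *.
elim: n => [|n IH]; first by rewrite muln0.
have -> : (2 * n.+1)%nat = (2 * n).+2 by lia.
have := @shanks_telescope x n n x01 (leqnn n).
rewrite -[psum _ n.+1]/(psum _ n + _) -[psum _ (2 * n).+2]/(psum _ (2 * n) + _ + _) -IH.
have -> : ((2 * n).+2 + 1)%nat = (2 * n + 3)%nat by lia.
have -> f g : psum (fun k => f k - g k) n = psum f n - psum g n.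
  have -> : psum f n = psum (fun k => f k - g k + g k) n by apply: psum_ext => k _; ring.
  by rewrite psum_plus; ring.
move=> T; have {T} -> : psum (fun k => evenodd x n.+1 / evenodd x k * (x ^ k) ^ (2 * n + 3)) n
  = evenodd x n / evenodd x n * (x ^ n) ^ (2 * n + 1) * (1 - x ^ n * x ^ n) / (1 - x ^ n * x ^ n * x)
   + psum (fun k => evenodd x n / evenodd x k * (x ^ k) ^ (2 * n + 1)) n by rewrite -T; ring.
have e2 := evenodd_ge1 n x01.
have E3 : (x ^ n) ^ (2 * n + 3) = (x ^ n) ^ (2 * n + 1) * (x ^ n * x ^ n).
  by rewrite (_ : (2 * n + 3)%nat = ((2 * n + 1) + 2)%nat) ?pow_add /=; [ring | lia].
have E1 : exp (- (s * (INR (2 * n) * (INR (2 * n) + 1)))) = (x ^ n) ^ (2 * n + 1).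
  rewrite -pow_mult ex !(mult_INR, plus_INR); congr exp; rewrite /=; ring.
have E2 : exp (- (s * (INR (2 * n).+1 * (INR (2 * n).+1 + 1)))) = (x ^ n) ^ (2 * n + 1) * (x ^ n * x ^ n * x).
  rewrite -{4}[x]pow_1 -!pow_mult -!pow_add ex S_INR !(mult_INR, plus_INR).
  by congr exp; rewrite /=; ring.
rewrite E1 E2 E3 /=; set A := (x ^ n) ^ (2 * n + 1); set c := x ^ n.
have cb : 0 < c <= 1 := pow_bounds n x01.
have c2 : 0 < c * c <= 1 by nra.
have c2x : 0 < c * c * x < 1 by nra.
by field; repeat split; nra.
Qed.

(** Multiplying top and bottom by prod_(k<=n) (1 - x^(2k)) fills the denominator up to prod_(k<=2n)
    (1 - x^k) and squares the numerator. In the limit this gives 2 F(2u) - F(u), hence T_2. *)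
Lemma ln_evenodd (u : R) (n : nat) : 0 < u ->
  ln (evenodd (exp (- u)) n)
  = 2 * psum (fun k => ln1mexp ((1 + INR k) * (2 * u))) n
    - psum (fun k => ln1mexp ((1 + INR k) * u)) (2 * n).
Proof.
move=> u0; have x01 := exp_neg_bounds u0.
have ex k : exp (- u) ^ k = exp (- (u * INR k)).
  by rewrite exp_pow_INR; congr exp; ring.
elim: n => [|n IH]; first by rewrite muln0 /= ln_1; ring.
have -> : (2 * n.+1)%nat = (2 * n).+2 by lia.
have e1 : 0 < evenodd (exp (- u)) n by have := evenodd_ge1 n x01; lra.
have p1 : 0 < (1 + INR n) * (2 * u) by have := pos_INR n; nra.
have p2 : 0 < (1 + INR (2 * n)) * u by have := pos_INR (2 * n); nra.
have b1 := exp_neg_bounds p1; have b2 := exp_neg_bounds p2.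
have E1 : exp (- u) ^ n * exp (- u) ^ n * exp (- u) = exp (- ((1 + INR (2 * n)) * u)).
  by rewrite ex -!exp_plus mult_INR; congr exp; rewrite /=; ring.
have E2 : exp (- u) ^ n * exp (- u) ^ n * exp (- u) * exp (- u) = exp (- ((1 + INR n) * (2 * u))).
  by rewrite ex -!exp_plus; congr exp; rewrite /=; ring.
have r0 : 0 < (1 - exp (- ((1 + INR n) * (2 * u)))) / (1 - exp (- ((1 + INR (2 * n)) * u))).
  by apply: Rdiv_lt_0_compat; lra.
rewrite -[evenodd _ n.+1]/(evenodd _ n * _) E2 E1 ln_mult // IH ln_div; try lra.
rewrite -[psum _ n.+1]/(psum _ n + _) -[psum _ (2 * n).+2]/(psum _ (2 * n) + _ + _).
have -> : (1 + INR (2 * n).+1) * u = (1 + INR n) * (2 * u).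
  by rewrite S_INR mult_INR /=; ring.
by rewrite /ln1mexp; ring.
Qed.

(** The value of sum_(k>=0) e^(-s k(k+1)), taken from the product side: at x = e^(-2s) the logarithm
    of the product is 2 F(4s) - F(2s) = T_2(4s) - ln (4s) / 2. *)
Definition halftheta (s : R) : R := exp (defect 2 (4 * s) - ln (4 * s) / 2).

Lemma halftheta_cv (s : R) : 0 < s ->
  Un_cv (psum (fun k => exp (- (s * (INR k * (INR k + 1)))))) (halftheta s).
Proof.
move=> s0; set f := fun k : nat => _; pose x := exp (- (2 * s)).
have x01 : 0 < x < 1 by apply: exp_neg_bounds; lra.
have f0 n : 0 <= f n by apply/Rlt_le/exp_pos.
have Pcv : Un_cv (evenodd x) (halftheta s).
  apply: (@cv_ext (fun n => exp (ln (evenodd x n)))).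
    by move=> n; rewrite exp_ln //; have := evenodd_ge1 n x01; lra.
  have -> : halftheta s = exp (2 * lnpoch 1 (2 * (2 * s)) - lnpoch 1 (2 * s)).
    rewrite /halftheta /defect; congr exp; rewrite -[INR 2]/(1 + 1).
    have -> : 4 * s / (1 + 1) = 2 * s by field.
    have -> : 2 * (2 * s) = 4 * s by ring.
    field.
  apply: cv_comp; first exact/derivable_continuous_pt/derivable_pt_exp.
  apply: (@cv_ext (fun n => 2 * psum (fun k => ln1mexp ((1 + INR k) * (2 * (2 * s)))) n
    - psum (fun k => ln1mexp ((1 + INR k) * (2 * s))) (2 * n))).
    by move=> n; rewrite ln_evenodd //; lra.
  apply: CV_minus; first by apply/cv_scal/lnpoch_cv; lra.
  apply: (@cv_subseq _ _ (muln 2)) => [n|]; first lia.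
  by apply: lnpoch_cv; lra.
have Pcv' : Un_cv (fun n => evenodd x n.+1) (halftheta s) by apply: (@cv_subseq _ _ S).
have even_cv : Un_cv (fun n => psum f (2 * n.+1)) (halftheta s).
  (* In the Shanks sum the term k = 0 is the product P itself, and the term k + 1 is at most P X
     x^k, where X = x^(2(n+1)+1) tends to 0. *)
  apply: (@cv_squeeze (fun n => evenodd x n.+1) _
    (fun n => evenodd x n.+1 * (1 + x ^ (2 * n.+1 + 1) * / (1 - x)))) => //.
    move=> n; rewrite -shanks // -/x.
    have e1 := evenodd_ge1 n.+1 x01.
    pose X := x ^ (2 * n.+1 + 1).
    have XB : 0 < X <= 1 by apply: pow_bounds.
    have X1 : X <= x.
      have := pow_bounds (2 * n.+1) x01.
      by rewrite /X addn1 -[x ^ (_).+1]/(x * x ^ (2 * n.+1)); nra.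
    rewrite -/X psum_recl pow1 -[evenodd x 0]/1.
    have -> : evenodd x n.+1 / 1 * 1 = evenodd x n.+1 by field.
    set P := evenodd x n.+1 in e1 *.
    have low : 0 <= psum (fun k => P / evenodd x k.+1 * (x ^ k.+1) ^ (2 * n.+1 + 1)) n.
      apply: psum_ge0 => k; apply: Rmult_le_pos; last by apply/pow_le/pow_le; lra.
      by apply: Rdiv_le_0_compat; [lra | have := evenodd_ge1 k.+1 x01; lra].
    split; first lra.
    have up : psum (fun k => P / evenodd x k.+1 * (x ^ k.+1) ^ (2 * n.+1 + 1)) n
        <= psum (fun k => P * X * x ^ k) n.
      apply: psum_le => k _.
      have -> : (x ^ k.+1) ^ (2 * n.+1 + 1) = X * X ^ k.
        by rewrite -pow_mult Nat.mul_comm pow_mult.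
      have ek := evenodd_ge1 k.+1 x01.
      have h1 : P / evenodd x k.+1 <= P.
        have := @Rinv_le_contravar 1 _ Rlt_0_1 ek; rewrite Rinv_1 /Rdiv => h1; nra.
      have h2 : X ^ k <= x ^ k by apply: pow_incr; lra.
      have h3 := pow_le X k ltac:(lra).
      have X0 : 0 <= X * X ^ k by nra.
      apply: Rle_trans (Rmult_le_compat_r _ _ _ X0 h1) _.
      by rewrite Rmult_assoc; apply: Rmult_le_compat_l; [lra | apply: Rmult_le_compat_l; lra].
    rewrite psum_scal in up.
    have := @psum_geom_le x n ltac:(lra).
    have : 0 < P * X by nra.
    by move=> p1 p2; have := Rmult_le_compat_l _ _ _ (Rlt_le _ _ p1) p2; lra.
  have -> : halftheta s = halftheta s * (1 + 0 * / (1 - x)) by ring.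
  apply: CV_mult => //; apply: CV_plus; first exact: cv_const.
  apply: CV_mult; last exact: cv_const.
  apply: (@cv_subseq _ _ (fun n => (2 * n.+1 + 1)%nat)) => [n|]; first lia.
  by apply: cv_pow0; lra.
(* Sums of even length dominate all others, so the whole series converges; the even subsequence then
   identifies its limit. *)
have [||L HL] := @cv_psum_bounded f (halftheta s) => //.
  move=> N; apply: Rle_trans (_ : psum f (2 * N.+1) <= _).
    have -> : (2 * N.+1)%nat = (N + N.+2)%nat by lia.
    by rewrite psum_add; have := psum_ge0 N.+2 (fun n => f0 (N + n)%nat); lra.
  apply: (growing_ineq (fun n => psum f (2 * n.+1))) => // n.
  have -> : (2 * n.+2)%nat = (2 * n.+1).+2 by lia.
  rewrite -[psum f (2 * n.+1).+2]/(psum f (2 * n.+1) + _ + _).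
  by have := f0 (2 * n.+1)%nat; have := f0 (2 * n.+1).+1; lra.
suff -> : halftheta s = L by [].
apply: UL_sequence even_cv _; apply: (@cv_subseq _ _ (fun n => (2 * n.+1)%nat)) => [n|//]; lia.
Qed.

(** * Gaussian sums over boxes *)

Definition gauss (s x : R) : R := exp (- (s * x ^ 2)).

Lemma gauss_ge0 (s x : R) : 0 <= gauss s x.
Proof. exact/Rlt_le/exp_pos. Qed.

Lemma exp_le_compat (x y : R) : x <= y -> exp x <= exp y.
Proof. by case=> [lt|->]; [apply/Rlt_le/exp_increasing | lra]. Qed.

Lemma gauss_even (s x : R) : gauss s (- x) = gauss s x.
Proof. by rewrite /gauss; congr exp; ring. Qed.

(** Since k^2 <= k(k+1) <= (k+1)^2, these terms interlace with the Gaussian at the integers and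
    serve for upper and lower comparison alike. *)
Definition gauss_mid (s : R) (k : nat) : R := exp (- (s * (INR k * (INR k + 1)))).

Lemma psum_gauss_mid_le (s : R) (N : nat) : 0 < s -> psum (gauss_mid s) N <= halftheta s.
Proof.
move=> s0; apply: (growing_ineq (psum (gauss_mid s))); last exact: halftheta_cv.
by move=> n /=; have := exp_pos (- (s * (INR n * (INR n + 1)))); rewrite /gauss_mid; lra.
Qed.

Lemma psum_gauss_pos (s c : R) (M : nat) : 0 < s -> 0 <= c ->
  psum (fun i => gauss s (INR i + c)) M <= halftheta s + 1.
Proof.
move=> s0 c0; case: M => [|M].
  by have := @psum_gauss_mid_le s 0 s0; rewrite /=; lra.
rewrite psum_recl.
have h0 : gauss s (INR 0 + c) <= 1.
  by rewrite -exp_0; apply: exp_le_compat; have := pow2_ge_0 (INR 0 + c); nra.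
have : psum (fun i => gauss s (INR i.+1 + c)) M <= psum (gauss_mid s) M.
  apply: psum_le => i _; apply: exp_le_compat; rewrite S_INR.
  have i0 := pos_INR i.
  have : INR i * (INR i + 1) <= (INR i + 1 + c) ^ 2 by nra.
  by nra.
by have := psum_gauss_mid_le M s0; lra.
Qed.

(** Reversing the order of summation and changing sign moves the offset c to 1 - (M + c) >= 0. *)
Lemma psum_gauss_neg (s c : R) (M : nat) : 0 < s -> INR M + c <= 1 ->
  psum (fun i => gauss s (INR i + c)) M <= halftheta s + 1.
Proof.
move=> s0 c0; rewrite psum_rev.
have := @psum_gauss_pos s (1 - (INR M + c)) M s0 ltac:(lra).
rewrite (@psum_ext (fun n => gauss s (INR (M - n.+1)%nat + c))
  (fun i => gauss s (INR i + (1 - (INR M + c))))) // => i iM.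
rewrite -gauss_even; congr gauss; rewrite minus_INR ?S_INR; [ring | exact/leP].
Qed.

(* The terms left and right of the peak at [-c] are dominated separately. *)
Lemma psum_gauss_upper (s c : R) (M : nat) : 0 < s ->
  psum (fun i => gauss s (INR i + c)) M <= 2 * halftheta s + 2.
Proof.
move=> s0.
(* The index m cuts the window at the peak; the alternatives m = 0 and m = M cover a peak outside
   the window. *)
have [m [mM [left_ right_]]] : exists m, (m <= M)%nat /\ (m = 0%nat \/ INR m + c <= 1)
    /\ (m = M \/ 0 <= INR m + c).
  elim: M => [|M [m [mM [hl hr]]]]; first by exists 0%nat; split=> //; split; left.
  case: (Rle_or_lt (INR M.+1 + c) 1) => h.
    by exists M.+1; split=> //; split; [right | left].
  exists m; split; first exact: leqW.
  split=> //; right; case: hr => [->|//].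
  by move: h; rewrite S_INR; lra.
rewrite -(subnKC mM) psum_add.
have V0 : 0 <= halftheta s := Rlt_le _ _ (exp_pos _).
have h1 : psum (fun i => gauss s (INR i + c)) m <= halftheta s + 1.
  by case: left_ => [->|h]; [rewrite /=; lra | exact: psum_gauss_neg].
suff : psum (fun n => gauss s (INR (m + n) + c)) (M - m) <= halftheta s + 1 by lra.
case: right_ => [->|h]; first by rewrite subnn /=; lra.
apply: Rle_trans (psum_gauss_pos (M - m) s0 h); apply: psum_le => i _.
by rewrite plus_INR; apply: Req_le; congr gauss; ring.
Qed.

Lemma psum_window (f : nat -> R) (a M K : nat) : (forall n, 0 <= f n) ->
  (a + M <= K)%nat -> psum (fun i => f (a + i)%nat) M <= psum f K.
Proof.
move=> f0 le; rewrite -(subnKC le) !psum_add.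
have := psum_ge0 a f0.
by have := psum_ge0 (K - (a + M)) (fun n => f0 (a + M + n)%nat); lra.
Qed.

(** That is, liminf u >= L: a window captures the shifted peak only for large N. *)
Definition eventually_ge (u : nat -> R) (L : R) : Prop :=
  forall eps, 0 < eps -> exists N0, forall N, (N0 <= N)%nat -> L - eps <= u N.

(** The loss of 2 is the term [gauss_mid s 0], equal to 1, dropped on each side of the peak. *)
Lemma psum_gauss_lower (s c : R) : 0 < s ->
  eventually_ge (fun N => psum (fun i => gauss s (INR i - INR N + c)) (2 * N + 1))
    (2 * halftheta s - 2).
Proof.
move=> s0 eps e0.
have [J0 HJ] := halftheta_cv s0 (eps := eps / 2) ltac:(lra).
pose J := J0; have {HJ} HJ : halftheta s - eps / 2 <= psum (gauss_mid s) J.+1.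
  by have := HJ J.+1 ltac:(lia) => /Rabs_def2; rewrite /gauss_mid; lra.
rewrite psum_recl in HJ.
have g0 : gauss_mid s 0 = 1.
  by rewrite /gauss_mid -exp_0; congr exp; rewrite /=; ring.
rewrite g0 in HJ.
(* Here 0 < m + c <= 1, so the samples m + j and m - j - 1 are both within j + 1 of the peak. Below,
   a is the position of m in the window, and N is large enough for J samples on either side to
   fit. *)
have [m1 m2] := archimed (- c); set m := up (- c) in m1 m2.
exists (Z.abs_nat m + J + 1)%nat => N HN.
pose a := Z.to_nat (m + Z.of_nat N).
have aE : INR a = IZR m + INR N.
  by rewrite INR_IZR_INZ Z2Nat.id; [rewrite plus_IZR -INR_IZR_INZ | lia].
have aJ : (J <= a)%nat by rewrite /a; lia.
have aK : (a + J <= 2 * N + 1)%nat by rewrite /a; lia.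
pose f i := gauss s (INR i - INR N + c).
have f0 i : 0 <= f i := gauss_ge0 _ _.
have lo (n : nat) (x : R) : - (INR n + 1) <= x <= INR n + 1 -> gauss_mid s n.+1 <= gauss s x.
  move=> hx; apply: exp_le_compat; rewrite S_INR; have := pos_INR n.
  have : x ^ 2 <= (INR n + 1) ^ 2 by nra.
  nra.
have := @psum_window f (a - J) (J + J) (2 * N + 1) f0 ltac:(lia).
rewrite psum_add.
have r1 : psum (fun k => gauss_mid s k.+1) J <= psum (fun n => f (a - J + (J + n))%nat) J.
  apply: psum_le => j jJ; apply: lo.
  have -> : (a - J + (J + j))%nat = (a + j)%nat by lia.
  by rewrite plus_INR aE; have := pos_INR j; lra.
have r2 : psum (fun k => gauss_mid s k.+1) J <= psum (fun n => f (a - J + n)%nat) J.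
  rewrite [X in _ <= X]psum_rev; apply: psum_le => j jJ; apply: lo.
  have E : (a - J + (J - j.+1) + j.+1)%nat = a by lia.
  have := f_equal INR E; rewrite plus_INR S_INR aE => E'.
  by have := pos_INR j; lra.
rewrite /f in r1 r2 *; lra.
Qed.

Lemma eventually_ge_plus (u v : nat -> R) (L M : R) :
  eventually_ge u L -> eventually_ge v M -> eventually_ge (fun N => u N + v N) (L + M).
Proof.
move=> uL vM eps e0; have [N1 H1] := uL (eps / 2) ltac:(lra).
have [N2 H2] := vM (eps / 2) ltac:(lra).
exists (N1 + N2)%nat => N HN; have := H1 N ltac:(lia); have := H2 N ltac:(lia); lra.
Qed.

Lemma eventually_ge_scal (c : R) (u : nat -> R) (L : R) :
  0 <= c -> eventually_ge u L -> eventually_ge (fun N => c * u N) (c * L).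
Proof.
move=> c0 uL eps e0.
have q0 : 0 < eps / (c + 1) by apply: Rdiv_lt_0_compat; lra.
have E : (c + 1) * (eps / (c + 1)) = eps by field; lra.
by have [N0 H] := uL _ q0; exists N0 => N /H h; nra.
Qed.

Lemma eventually_ge_psum (u : nat -> nat -> R) (L : nat -> R) (M : nat) :
  (forall i, eventually_ge (u i) (L i)) ->
  eventually_ge (fun N => psum (fun i => u i N) M) (psum L M).
Proof.
move=> H; elim: M => /= [|M IH]; last exact: eventually_ge_plus.
by move=> eps e0; exists 0%nat => N _; lra.
Qed.

Definition vcons (l : nat) (a : R) (x : 'I_l -> R) : 'I_l.+1 -> R :=
  fun i => oapp x a (unlift ord0 i).

(** The first coordinate is summed innermost, since it is the one in which the square is
    completed. *)
Fixpoint boxsum (l N : nat) : (('I_l -> R) -> R) -> R :=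
  match l with
  | 0%nat => fun F => F (fun=> 0)
  | k.+1 => fun F => boxsum N (fun x : 'I_k -> R =>
      psum (fun i => F (vcons (INR i - INR N) x)) (2 * N + 1))
  end.

Lemma boxsum_le (l N : nat) (F H : ('I_l -> R) -> R) :
  (forall x, F x <= H x) -> boxsum N F <= boxsum N H.
Proof.
elim: l F H => [|l IH] F H FH /=; first exact: FH.
by apply: IH => x; apply: psum_le => i _; exact: FH.
Qed.

Lemma boxsum_scal (l N : nat) (c : R) (F : ('I_l -> R) -> R) :
  boxsum N (fun x => c * F x) = c * boxsum N F.
Proof.
elim: l F => [|l IH] F //=; rewrite -IH; congr (boxsum N _).
by apply: functional_extensionality => x; rewrite psum_scal.
Qed.

Lemma boxsum_mono (l M N : nat) (F : ('I_l -> R) -> R) : (M <= N)%nat ->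
  (forall x, 0 <= F x) -> boxsum M F <= boxsum N F.
Proof.
move=> MN; elim: l F => [|l IH] F F0 /=; first lra.
apply: Rle_trans (IH _ _); last by move=> x; apply: psum_ge0.
apply: boxsum_le => x.
have := @psum_window (fun i => F (vcons (INR i - INR N) x)) (N - M) (2 * M + 1) (2 * N + 1)
  (fun=> F0 _) ltac:(lia).
apply: Rle_trans; apply: psum_le => i _; apply: Req_le; congr (F (vcons _ x)).
by rewrite plus_INR minus_INR; [ring | exact/leP].
Qed.

(** The box keeps its size M while N grows inside, so only finitely many thresholds, depending on x,
    are combined. *)
Lemma eventually_ge_boxsum (l M : nat) (u : nat -> ('I_l -> R) -> R) (L : ('I_l -> R) -> R) :
  (forall x, eventually_ge (u^~ x) (L x)) ->
  eventually_ge (fun N => boxsum M (u N)) (boxsum M L).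
Proof.
elim: l u L => [|l IH] u L H /=; first exact: H.
apply: (IH (fun N x => psum (fun i => u N (vcons (INR i - INR M) x)) (2 * M + 1))) => x.
by apply: (eventually_ge_psum (u := fun i N => u N (vcons (INR i - INR M) x))).
Qed.

Lemma psum_big (f : nat -> R) (n : nat) : psum f n = \big[Rplus/0]_(i < n) f i.
Proof. by elim: n => [|n IH]; rewrite ?big_ord0 ?big_ord_recr //= IH. Qed.

Lemma Rsum_big (T : Type) (s : seq T) (f : T -> R) : Rsum s f = \big[Rplus/0]_(a <- s) f a.
Proof. by elim: s => [|a s IH]; rewrite ?big_nil ?big_cons //= IH. Qed.

Lemma Rsum_boxsum (l N : nat) (F : ('I_l -> R) -> R) :
  Rsum (enum [pred k : {ffun 'I_l -> 'I_(2 * N + 1)} | true])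
    (fun k => F (fun i => INR (k i) - INR N)) = boxsum N F.
Proof.
rewrite Rsum_big big_enum /=.
elim: l F => [|l IH] F.
  rewrite (big_pred1 [ffun i : 'I_0 => cast_ord (esym (addn1 _)) ord0]).
    by congr F; apply: functional_extensionality; case.
  by move=> k; apply/esym/eqP/ffunP; case.
rewrite /= -IH; under [RHS]eq_bigr => k _ do rewrite psum_big.
rewrite pair_bigA /=.
pose h (q : {ffun 'I_l -> 'I_(2 * N + 1)} * 'I_(2 * N + 1)) :=
  [ffun j : 'I_l.+1 => oapp q.1 q.2 (unlift ord0 j)].
rewrite (reindex h) /=; last first.
  exists (fun k => ([ffun j => k (lift ord0 j)], k ord0)) => [[q i]|k] _.
    by congr pair; [apply/ffunP => j|]; rewrite !ffunE ?liftK ?unlift_none.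
  by apply/ffunP => j; rewrite ffunE; case: unliftP => [j' ->|->] //=; rewrite ffunE.
apply: eq_bigr => q _; congr F; apply: functional_extensionality => j.
by rewrite /vcons ffunE; case: unliftP.
Qed.

(** * Quadratic forms and the theta series *)

Definition qf (l : nat) (B : 'M[R]_l) (x : 'I_l -> R) : R :=
  \big[Rplus/0]_i \big[Rplus/0]_j (B i j * x i * x j).

Definition schur (l : nat) (B : 'M[R]_l.+1) : 'M[R]_l :=
  \matrix_(i, j) (B (lift ord0 i) (lift ord0 j)
    - B ord0 (lift ord0 i) * B ord0 (lift ord0 j) / B ord0 ord0).

Definition linpart (l : nat) (B : 'M[R]_l.+1) (x : 'I_l -> R) : R :=
  \big[Rplus/0]_j (B ord0 (lift ord0 j) * x j).

Lemma vcons0 (l : nat) (a : R) (x : 'I_l -> R) : vcons a x ord0 = a.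
Proof. by rewrite /vcons unlift_none. Qed.

Lemma vconsS (l : nat) (a : R) (x : 'I_l -> R) i : vcons a x (lift ord0 i) = x i.
Proof. by rewrite /vcons liftK. Qed.

Lemma big_Rplus_scal (I : finType) (c : R) (F : I -> R) :
  \big[Rplus/0]_i (c * F i) = c * \big[Rplus/0]_i F i.
Proof. by rewrite big_distrr. Qed.

Lemma qf_vcons (l : nat) (B : 'M[R]_l.+1) (a : R) (x : 'I_l -> R) : trmx B = B ->
  qf B (vcons a x) = B ord0 ord0 * a ^ 2 + 2 * a * linpart B x
    + \big[Rplus/0]_i \big[Rplus/0]_j (B (lift ord0 i) (lift ord0 j) * x i * x j).
Proof.
move=> Bs; set v := vcons a x.
have E0 : \big[Rplus/0]_j (B ord0 j * v ord0 * v j) = B ord0 ord0 * a ^ 2 + a * linpart B x.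
  rewrite big_ord_recl /v !vcons0 -big_Rplus_scal; congr (_ + _); first ring.
  by apply: eq_bigr => i _; rewrite vconsS; ring.
have E1 i : \big[Rplus/0]_j (B (lift ord0 i) j * v (lift ord0 i) * v j)
    = a * (B ord0 (lift ord0 i) * x i)
      + \big[Rplus/0]_j (B (lift ord0 i) (lift ord0 j) * x i * x j).
  rewrite big_ord_recl /v vcons0 vconsS; congr (_ + _); first by rewrite -{1}Bs mxE; ring.
  by apply: eq_bigr => j _; rewrite vconsS.
rewrite /qf big_ord_recl E0 (eq_bigr _ (fun i _ => E1 i)) big_split /= big_Rplus_scal.
rewrite -/(linpart B x); ring.
Qed.

Lemma qf_schur (l : nat) (B : 'M[R]_l.+1) (x : 'I_l -> R) : B ord0 ord0 <> 0 ->
  \big[Rplus/0]_i \big[Rplus/0]_j (B (lift ord0 i) (lift ord0 j) * x i * x j)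
  = qf (schur B) x + (linpart B x) ^ 2 / B ord0 ord0.
Proof.
move=> a0; rewrite /qf.
have -> : (linpart B x) ^ 2 / B ord0 ord0 = \big[Rplus/0]_i \big[Rplus/0]_j
   (B ord0 (lift ord0 i) * x i * / B ord0 ord0 * (B ord0 (lift ord0 j) * x j)).
  under eq_bigr => i _ do rewrite big_Rplus_scal Rmult_comm.
  rewrite big_Rplus_scal -/(linpart B x).
  under eq_bigr => i _ do rewrite Rmult_comm.
  by rewrite big_Rplus_scal -/(linpart B x); field.
rewrite -big_split; apply: eq_bigr => i _; rewrite -big_split; apply: eq_bigr => j _.
by rewrite mxE /=; field.
Qed.

Lemma qf_square (l : nat) (B : 'M[R]_l.+1) (a : R) (x : 'I_l -> R) : trmx B = B ->
  B ord0 ord0 <> 0 ->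
  qf B (vcons a x)
  = B ord0 ord0 * (a + linpart B x / B ord0 ord0) ^ 2 + qf (schur B) x.
Proof. by move=> Bs a0; rewrite qf_vcons // qf_schur //; field. Qed.

(** Left multiplication by the unit lower triangular [E] clears the first column below the pivot. *)
Lemma det_schur (l : nat) (B : 'M[R]_l.+1) : trmx B = B -> B ord0 ord0 <> 0 ->
  determinant B = B ord0 ord0 * determinant (schur B).
Proof.
move=> Bs a0; pose C : 'M[R]_(1 + l) := B.
pose E : 'M[R]_(1 + l) := block_mx (scalar_mx 1) (const_mx 0)
    (\col_i (- (B ord0 (lift ord0 i) / B ord0 ord0))) (scalar_mx 1).
have dE : determinant E = 1 by rewrite det_lblock !det1 mulr1.
have EC : mulmx E C = block_mx (ulsubmx C) (ursubmx C) (const_mx 0) (schur B).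
  rewrite -{1}[C]submxK mulmx_block !mul1mx !mul0mx !addr0; congr block_mx.
    apply/matrixP => i j; rewrite !mxE big_ord1 !mxE (ord1 j) /=.
    have -> : lshift l (ord0 : 'I_1) = ord0 by apply/val_inj.
    have -> : rshift 1 i = lift ord0 i by apply/val_inj.
    have h : B (lift ord0 i) ord0 = B ord0 (lift ord0 i) by rewrite -{1}Bs mxE.
    by rewrite /C h -!RplusE -!RmultE; change (1 + l)%nat with l.+1; field.
  apply/matrixP => i j; rewrite !mxE big_ord1 !mxE /=.
  have -> : lshift l (ord0 : 'I_1) = ord0 by apply/val_inj.
  have rE k : rshift 1 k = lift ord0 k by apply/val_inj.
  by rewrite !rE -!RplusE -!RmultE /C; change (1 + l)%nat with l.+1; field.
have := det_mulmx E C; rewrite dE EC mul1r det_ublock => <-.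
rewrite [ulsubmx C]mx11_scalar det_scalar1 !mxE -RmultE.
by congr Rmult; congr (fun_of_matrix B _ _); apply/val_inj.
Qed.

Definition mat_posdef (l : nat) (B : 'M[R]_l) : Prop :=
  forall x : 'I_l -> R, (exists i, x i <> 0) -> 0 < qf B x.

Lemma posdef_pivot (l : nat) (B : 'M[R]_l.+1) :
  trmx B = B -> mat_posdef B -> 0 < B ord0 ord0.
Proof.
move=> Bs pB; have := pB (vcons 1 (fun=> 0)); rewrite qf_vcons //.
rewrite /linpart !big1; first last.
- by move=> i _; ring.
- by move=> i _; apply: big1 => j _; ring.
have -> : B ord0 ord0 * 1 ^ 2 + 2 * 1 * 0 + 0 = B ord0 ord0 by ring.
by apply; exists ord0; rewrite vcons0; lra.
Qed.

(** The first coordinate is chosen to make the square in [qf_square] vanish. *)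
Lemma posdef_schur (l : nat) (B : 'M[R]_l.+1) :
  trmx B = B -> mat_posdef B -> mat_posdef (schur B).
Proof.
move=> Bs pB x [i xi]; have a0 := posdef_pivot Bs pB.
have := pB (vcons (- (linpart B x / B ord0 ord0)) x); rewrite qf_square //; last lra.
have -> : B ord0 ord0 * (- (linpart B x / B ord0 ord0) + linpart B x / B ord0 ord0) ^ 2
  + qf (schur B) x = qf (schur B) x by ring.
by apply; exists (lift ord0 i); rewrite vconsS.
Qed.

Lemma schur_sym (l : nat) (B : 'M[R]_l.+1) : trmx B = B -> trmx (schur B) = schur B.
Proof.
move=> Bs; apply/matrixP => i j; rewrite !mxE -{1}Bs mxE.
by congr (_ - _ / _); ring.
Qed.

Definition prod_over (f : R -> R) (b : seq R) : R := foldr (fun z acc => f z * acc) 1 b.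

Lemma prod_over_cons (f : R -> R) (z : R) (b : seq R) :
  prod_over f (z :: b) = f z * prod_over f b.
Proof. by []. Qed.

Definition gauss_hi (s : R) : R := 2 * halftheta s + 2.
(** The maximum makes the bound visibly nonnegative, as needed when lower bounds are multiplied. *)
Definition gauss_lo (s : R) : R := Rmax 0 (2 * halftheta s - 2).

Lemma gauss_lower_pos (s c : R) : 0 < s ->
  eventually_ge (fun N => psum (fun i => gauss s (INR i - INR N + c)) (2 * N + 1)) (gauss_lo s).
Proof.
move=> s0 eps e0; have [N0 H] := psum_gauss_lower c s0 e0; exists N0 => N /H.
rewrite /gauss_lo /Rmax; case: Rle_dec => // _ _.
by have := psum_ge0 (2 * N + 1) (fun i => gauss_ge0 s (INR i - INR N + c)); lra.
Qed.

(* Completing the square in the first coordinate turns the innermost sum into a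
   shifted one-dimensional Gaussian sum, whose bounds do not depend on the shift. *)
Lemma theta_bounds (l : nat) (B : 'M[R]_l) : trmx B = B -> mat_posdef B ->
  exists b : seq R, [/\ size b = l, all [pred z | Rlt_dec 0 z] b, prod_over id b = determinant B &
    forall t, 0 < t ->
      (forall N, boxsum N (fun x => exp (- (t * qf B x))) <= prod_over (fun z => gauss_hi (t * z)) b)
      /\ eventually_ge (fun N => boxsum N (fun x => exp (- (t * qf B x))))
           (prod_over (fun z => gauss_lo (t * z)) b)].
Proof.
elim: l B => [|l IH] B Bs pB.
  exists [::]; split=> //; first by rewrite det_mx00.
  move=> t t0; have E : exp (- (t * qf B (fun=> 0))) = 1.
    by rewrite /qf big_ord0 Rmult_0_r Ropp_0 exp_0.
  by split=> [N|eps e0]; [rewrite /= E; lra | exists 0%nat => N _; rewrite /= E; lra].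
have a0 := posdef_pivot Bs pB.
have [b [sb b0 db Hb]] := IH _ (schur_sym Bs) (posdef_schur Bs pB).
(* The list collects the pivots of the elimination, whose product is the determinant. *)
exists (B ord0 ord0 :: b); split=> /=.
- by rewrite sb.
- by rewrite b0 andbT; case: Rlt_dec.
- by rewrite db det_schur //; lra.
move=> t t0; have [Hu Hl] := Hb t t0.
have ta : 0 < t * B ord0 ord0 by nra.
pose S x := exp (- (t * qf (schur B) x)).
pose c (x : 'I_l -> R) := linpart B x / B ord0 ord0.
have sq N x : psum (fun i => exp (- (t * qf B (vcons (INR i - INR N) x)))) (2 * N + 1)
  = S x * psum (fun i => gauss (t * B ord0 ord0) (INR i - INR N + c x)) (2 * N + 1).
  rewrite -psum_scal; apply: psum_ext => i _; rewrite qf_square //; last lra.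
  by rewrite /S /gauss -exp_plus; congr exp; rewrite /c; ring.
have S0 x : 0 <= S x by apply/Rlt_le/exp_pos.
have Eb N : boxsum N (fun x => psum (fun i => exp (- (t * qf B (vcons (INR i - INR N) x)))) (2 * N + 1))
  = boxsum N (fun x => S x * psum (fun i => gauss (t * B ord0 ord0) (INR i - INR N + c x)) (2 * N + 1)).
  by congr (boxsum N _); apply: functional_extensionality => x.
split=> [N|].
  rewrite Eb; apply: Rle_trans (_ : gauss_hi (t * B ord0 ord0) * boxsum N S <= _).
    rewrite -boxsum_scal; apply: boxsum_le => x; rewrite Rmult_comm.
    apply: Rmult_le_compat_r => //.
    have := @psum_gauss_upper (t * B ord0 ord0) (- INR N + c x) (2 * N + 1) ta.
    apply: Rle_trans; apply: psum_le => i _; apply: Req_le; congr gauss; ring.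
  apply: Rmult_le_compat_l; last exact: Hu.
  have V0 : 0 < halftheta (t * B ord0 ord0) by exact: exp_pos.
  by rewrite /gauss_hi; lra.
have lo0 : 0 <= gauss_lo (t * B ord0 ord0) by apply: Rmax_l.
move=> eps e0.
(* Two limits in succession: M is fixed for the outer coordinates, then N is chosen for the inner
   sums over that box, and [boxsum_mono] finally enlarges the outer box to N. *)
have [M HM] := eventually_ge_scal lo0 Hl (eps := eps / 2) ltac:(lra).
have {HM} HM := HM M (leqnn M).
have [N0 HN] := @eventually_ge_boxsum l M
  (fun N x => S x * psum (fun i => gauss (t * B ord0 ord0) (INR i - INR N + c x)) (2 * N + 1))
  (fun x => S x * gauss_lo (t * B ord0 ord0))
  (fun x => eventually_ge_scal (S0 x) (gauss_lower_pos (c x) ta)) (eps / 2) ltac:(lra).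
exists (M + N0)%nat => N MN; rewrite Eb.
have h1 := HN N ltac:(lia).
have h2 := @boxsum_mono l M N
  (fun x => S x * psum (fun i => gauss (t * B ord0 ord0) (INR i - INR N + c x)) (2 * N + 1))
  ltac:(lia) (fun x => Rmult_le_pos _ _ (S0 x) (psum_ge0 _ (fun i => gauss_ge0 _ _))).
have E : boxsum M (fun x => S x * gauss_lo (t * B ord0 ord0)) = gauss_lo (t * B ord0 ord0) * boxsum M S.
  by rewrite -boxsum_scal; congr (boxsum M _); apply: functional_extensionality => x; ring.
by rewrite E in h1; rewrite -/S in HM; lra.
Qed.

(** * Eigenvalue multiplicities *)

Section Multiplicities.
Local Open Scope ring_scope.

Lemma rank_diag_mx (F : fieldType) (n : nat) (d : 'rV[F]_n) :
  \rank (diag_mx d) = (\sum_i (d ord0 i != GRing.zero))%nat.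
Proof.
elim: n d => [|n IH] d; first by rewrite big_ord0 thinmx0 mxrank0.
rewrite -[n.+1]/(1 + n)%nat in d *.
rewrite -{1}[d]hsubmxK diag_mx_row rank_diag_block_mx IH big_split_ord big_ord1 /=.
congr addn; last by apply: eq_bigr => i _; rewrite mxE.
have -> : diag_mx (lsubmx d) = lsubmx d.
  by apply/matrixP => i j; rewrite !mxE !ord1 eqxx.
rewrite rank_rV; congr (nat_of_bool (~~ _)); apply/eqP/eqP => [|h].
  by move/matrixP/(_ ord0 ord0); rewrite !mxE.
by apply/matrixP => i j; rewrite !mxE !ord1.
Qed.

Lemma char_poly_simmx (F : fieldType) (n : nat) (P A B : 'M[F]_n) :
  P \in unitmx -> P *m A = B *m P -> char_poly A = char_poly B.
Proof.
move=> Pu PA; pose Q := map_mx polyC P.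
have dQ : \det Q != 0 by rewrite det_map_mx polyC_eq0 -unitfE -unitmxE.
apply: (mulfI dQ); rewrite /char_poly -det_mulmx [RHS]mulrC -det_mulmx; congr (\det _).
by rewrite /char_poly_mx mulmxBr mulmxBl -!map_mxM PA scalar_mxC.
Qed.

(** After diagonalization both sides count the diagonal entries equal to a. *)
Lemma rank_eigenspace_diagonalizable (F : fieldType) (n : nat) (A : 'M[F]_n.+1) (a : F)
    (rs : seq F) :
  uniq rs -> mxminpoly A %| \prod_(x <- rs) ('X - x%:P) ->
  \rank (eigenspace A a) = mup a (char_poly A).
Proof.
move=> urs mrs; have [|P Pu] := (diagonalizableP A).2; first by exists rs.
case/diagonalizable_forPex => d /(simmxP Pu) PA.
rewrite (char_poly_simmx Pu PA) char_poly_trig ?diag_mx_is_trig //.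
have -> : \prod_i ('X - (diag_mx d i i)%:P) = \prod_(x <- [seq d ord0 i | i <- enum 'I_n.+1]) ('X - x%:P).
  by rewrite big_map big_enum; apply: eq_bigr => i _; rewrite mxE eqxx mulr1n.
rewrite mu_prod_XsubC /eigenspace mxrank_ker.
have -> : \rank (A - a%:M) = \rank (diag_mx (d - const_mx a)).
  have Pf : row_full P by rewrite row_full_unit.
  have Pr : row_free P by rewrite row_free_unit.
  rewrite -(eqmxMfull (A - a%:M) Pf) -(mxrankMfree (diag_mx (d - const_mx a)) Pr).
  by rewrite mulmxBr PA linearB /= mulmxBl diag_const_mx scalar_mxC.
rewrite rank_diag_mx count_map -sum1_count big_enum_cond /= [RHS]big_mkcond /=.
set u := bigop _ _ _; set v := bigop _ _ _.
have E : (u + v = n.+1)%nat.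
  rewrite /u /v -big_split /= -[RHS](card_ord n.+1) -sum1_card; apply: eq_bigr => i _.
  by rewrite !mxE subr_eq0; case: eqP.
by apply/eqP; rewrite -E addKn.
Qed.

Lemma mup_prod_exp (F : fieldType) (s : seq nat) (f : nat -> {poly F}) (k : nat -> nat) (x : F) :
  (forall d, d \in s -> f d != 0) ->
  mup x (\prod_(d <- s) f d ^+ k d) = (\sum_(d <- s) k d * mup x (f d))%nat.
Proof.
have pw (q : {poly F}) n : q != 0 -> mup x (q ^+ n) = (n * mup x q)%nat.
  move=> q0; elim: n => [|n IH]; first by rewrite mupNroot // root1.
  by rewrite exprS mupM ?expf_neq0 // IH mulSn.
elim: s => [|d s IH] f0; first by rewrite !big_nil mupNroot // root1.
have f0' e : e \in s -> f e != 0 by move=> es; apply: f0; rewrite inE es orbT.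
rewrite !big_cons mupM ?IH ?pw ?expf_neq0 ?f0 ?mem_head //.
by rewrite prodf_seq_neq0; apply/allP => e es /=; rewrite expf_neq0 // f0'.
Qed.

Lemma Xn_sub1_neq0 (F : nzRingType) (d : nat) : (0 < d)%nat -> 'X^d - 1 != 0 :> {poly F}.
Proof. by move=> d0; rewrite -size_poly_eq0 size_XnsubC. Qed.

(** As xi^(p/d) is a primitive d-th root of unity, X^d - 1 splits into distinct linear factors and
    every root is simple. *)
Lemma mup_Xn_sub1 (F : fieldType) (p d : nat) (xi x : F) :
  p.-primitive_root xi -> (0 < p)%nat -> (d %| p)%nat ->
  mup x ('X^d - 1) = (x ^+ d == 1) :> nat.
Proof.
move=> xip p0 dp; have d0 := dvdn_gt0 p0 dp.
have w := dvdn_prim_root xip dp; set z := xi ^+ _ in w.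
have E : 'X^d - 1 = \prod_(y <- [seq z ^+ i | i <- index_iota 0 d]) ('X - y%:P).
  by rewrite big_map factor_Xn_sub_1.
have rE : root ('X^d - 1) x = (x ^+ d == 1) by rewrite /root !hornerE subr_eq0.
case: eqVneq => [xd|nx]; last by rewrite mupNroot // rE.
apply/eqP; rewrite eqn_leq -XsubC_dvd ?Xn_sub1_neq0 // dvdp_XsubCl rE xd eqxx andbT.
rewrite E mu_prod_XsubC count_uniq_mem; first by case: (_ \in _).
rewrite map_inj_in_uniq ?iota_uniq // => i j; rewrite !mem_index_iota /= => id jd /eqP.
by rewrite (eq_prim_root_expr w) !modn_small // => /eqP.
Qed.

(** From sigma^p = 1 the minimal polynomial divides X^p - 1, which has simple roots, so geometric
    and algebraic multiplicities agree. *)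
Lemma rdim_mup (l p : nat) (sigma : 'M[int]_l) (xi : algC) (a : nat) :
  (2 <= p)%nat -> has_order sigma p -> p.-primitive_root xi ->
  rdim sigma xi a = mup (xi ^- a) (map_poly intr (char_poly sigma)).
Proof.
move=> p2 [sp sk] xip; case: l sigma sp sk => [|l] sigma sp sk.
  (* In rank 0 the only matrix is 1, whose order is 1 < p. *)
  by case: (sk 1%nat) => //; rewrite expr1; apply/matrixP => -[].
rewrite /rdim map_char_poly /=; set S : 'M[algC]_l.+1 := map_mx intr sigma.
have -> : char_poly S = char_poly S^T.
  by rewrite /char_poly -det_tr /char_poly_mx linearB /= tr_scalar_mx map_trmx.
pose rs := [seq xi ^+ i | i <- index_iota 0 p].
apply: (@rank_eigenspace_diagonalizable _ _ _ _ rs).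
  rewrite map_inj_in_uniq ?iota_uniq // => i j; rewrite !mem_index_iota /= => ip jp /eqP.
  by rewrite (eq_prim_root_expr xip) !modn_small // => /eqP.
rewrite big_map factor_Xn_sub_1 //; apply: mxminpoly_min.
rewrite rmorphB rmorph1 /= rmorphXn /= horner_mx_X.
have -> : S^T ^+ p = (S ^+ p)^T.
  by elim: p {p2 sp sk xip rs} => [|p IH]; rewrite ?expr0 ?trmx1 // exprS exprSr -mulmxE trmx_mul IH.
by rewrite -rmorphXn /= sp rmorph1 trmx1 subrr.
Qed.

(** The multiplicity of xi^(-a) is read off on both sides of [char_decomposition]; it is a root of
    X^d - 1 exactly when p divides ad. *)
Lemma rdim_balance (l p : nat) (sigma : 'M[int]_l) (xi : algC) (m : nat -> int) (a : nat) :
  (2 <= p)%nat -> has_order sigma p -> p.-primitive_root xi -> char_decomposition sigma p m ->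
  (rdim sigma xi a + \sum_(d <- divisors p) negp (m d) * (p %| a * d)
   = \sum_(d <- divisors p) posp (m d) * (p %| a * d))%nat.
Proof.
move=> p2 so xip cd; have p0 : (0 < p)%nat by apply: ltnW.
have dv d : d \in divisors p -> (d %| p)%nat by rewrite dvdn_divisors.
have nz d : d \in divisors p -> 'X^d - 1 != 0 :> {poly algC}.
  by move=> /dv dp; apply/Xn_sub1_neq0/(dvdn_gt0 p0 dp).
have mE k : mup (xi ^- a) (\prod_(d <- divisors p) ('X^d - 1) ^+ k d)
   = (\sum_(d <- divisors p) k d * (p %| a * d))%nat.
  rewrite mup_prod_exp // !big_seq; apply: eq_bigr => d /dv dp; congr muln.
  rewrite (mup_Xn_sub1 _ xip p0 dp) exprVn -exprM (prim_order_dvd xip).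
  by rewrite invr_eq1.
have mapE k : map_poly intr (\prod_(d <- divisors p) ('X^d - 1) ^+ k d : {poly int})
   = \prod_(d <- divisors p) ('X^d - 1) ^+ k d :> {poly algC}.
  by rewrite rmorph_prod; apply: eq_bigr => d _; rewrite rmorphXn rmorphB rmorph1 /= map_polyXn.
have := congr1 (fun q : {poly int} => mup (xi ^- a) (map_poly (intr : int -> algC) q)) cd.
have c0 : map_poly (intr : int -> algC) (char_poly sigma) != 0.
  by rewrite map_char_poly monic_neq0 // char_poly_monic.
have n0 k : \prod_(d <- divisors p) ('X^d - 1) ^+ k d != 0 :> {poly algC}.
  by rewrite prodf_seq_neq0; apply/allP => d /nz h /=; rewrite expf_neq0.
by rewrite /= rmorphM /= !mapE mupM // !mE -(rdim_mup _ p2 so xip).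
Qed.

(** If 1 were an eigenvalue over C, the integer det (sigma^T - 1) would vanish, which yields a
    nonzero fixed vector already in L. *)
Lemma rdim0 (l : nat) (sigma : 'M[int]_l) (xi : algC) :
  fixed_point_free sigma -> rdim sigma xi 0 = 0%nat.
Proof.
move=> fpf; apply/eqP; rewrite /rdim expr0 invr1 mxrank_eq0 /eigenspace kermx_eq0.
rewrite row_free_unit unitmxE unitfE.
have -> : (map_mx intr sigma)^T - 1%:M = map_mx intr (sigma^T - 1%:M) :> 'M[algC]_l.
  by rewrite map_mxB map_scalar_mx /= map_trmx.
rewrite det_map_mx intr_eq0; apply/negP => /det0P [v v0 /eqP].
rewrite mulmxBr mulmx1 subr_eq0 => /eqP vs; case/negP: v0; apply/eqP.
apply: trmx_inj; rewrite trmx0; apply: fpf.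
by rewrite -{2}vs trmx_mul trmxK.
Qed.

Lemma size_prod_exp (s : seq nat) (k : nat -> nat) : (forall d, d \in s -> (0 < d)%nat) ->
  (size (\prod_(d <- s) ('X^d - 1 : {poly int}) ^+ k d)).-1 = (\sum_(d <- s) k d * d)%nat.
Proof.
elim: s => [|d s IH] s0; first by rewrite !big_nil size_poly1.
have d0 := s0 d (mem_head _ _).
have s0' e : e \in s -> (0 < e)%nat by move=> es; apply: s0; rewrite inE es orbT.
rewrite !big_cons size_mul ?expf_neq0 ?Xn_sub1_neq0 //; last first.
  by rewrite prodf_seq_neq0; apply/allP => e es /=; rewrite expf_neq0 // Xn_sub1_neq0 // s0'.
have := IH s0'; set q := \prod_(_ <- _) _ => E.
have q0 : q != 0.
  by rewrite prodf_seq_neq0; apply/allP => e es /=; rewrite expf_neq0 // Xn_sub1_neq0 // s0'.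
have := size_exp ('X^d - 1 : {poly int}) (k d); rewrite size_XnsubC //= => E'.
have h1 : (0 < size q)%nat by rewrite size_poly_gt0.
have h2 : (0 < size (('X^d - 1 : {poly int}) ^+ k d))%nat.
  by rewrite size_poly_gt0 expf_neq0 // Xn_sub1_neq0.
rewrite -E [(k d * d)%nat]mulnC -E' -(prednK h1) -(prednK h2).
by rewrite addSn addnS.
Qed.

Lemma degree_balance (l p : nat) (sigma : 'M[int]_l) (m : nat -> int) :
  (0 < p)%nat -> char_decomposition sigma p m ->
  (l + \sum_(d <- divisors p) negp (m d) * d = \sum_(d <- divisors p) posp (m d) * d)%nat.
Proof.
move=> p0 cd; have dv d : d \in divisors p -> (0 < d)%nat.
  by rewrite -dvdn_divisors // => /(dvdn_gt0 p0).
have q0 : \prod_(d <- divisors p) ('X^d - 1 : {poly int}) ^+ negp (m d) != 0.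
  by rewrite prodf_seq_neq0; apply/allP => d ds /=; rewrite expf_neq0 // Xn_sub1_neq0 // dv.
have c0 : char_poly sigma != 0 by rewrite monic_neq0 // char_poly_monic.
rewrite -!size_prod_exp // -cd (size_mul c0 q0) size_char_poly.
by move: q0; rewrite -size_poly_gt0; case: (size _) => // k _; rewrite addnS.
Qed.

End Multiplicities.

(** * Characters as y tends to 0 *)

Lemma seq_lim_prod (y c : R) (r : nat) : 0 < y -> 0 < c ->
  seq_lim (prodR (fun n => (1 - qpow y (c + INR n)) ^ r)) = exp (INR r * lnpoch c (2 * PI * y)).
Proof.
move=> y0 c0; have pi0 := PI_RGT_0; have h0 : 0 < 2 * PI * y by nra.
apply: seq_lim_eq.
apply: (@cv_ext (fun N => exp (INR r * psum (fun n => ln1mexp ((c + INR n) * (2 * PI * y))) N))); last first.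
  apply: cv_comp; first exact/derivable_continuous_pt/derivable_pt_exp.
  by apply/cv_scal/lnpoch_cv.
elim=> [|N IH]; first by rewrite /= Rmult_0_r exp_0.
rewrite [RHS]/= -IH Rmult_plus_distr_l exp_plus; congr (_ * _).
have x0 : 0 < (c + INR N) * (2 * PI * y) by have := pos_INR N; nra.
have b := exp_neg_bounds x0.
have -> : 1 - qpow y (c + INR N) = exp (ln1mexp ((c + INR N) * (2 * PI * y))).
  by rewrite /ln1mexp exp_ln /qpow; [congr (1 - exp (- _)); ring | lra].
exact/esym/exp_pow_INR.
Qed.

Lemma prodR_exp (f : nat -> R) (N : nat) : prodR (fun n => exp (f n)) N = exp (psum f N).
Proof. by elim: N => [|N IH] /=; rewrite ?exp_0 // IH exp_plus. Qed.

Lemma prodR_ext (f g : nat -> R) (N : nat) :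
  (forall n, (n < N)%nat -> f n = g n) -> prodR f N = prodR g N.
Proof.
elim: N => //= N IH fg; congr (_ * _); last exact: fg.
by apply: IH => n nN; exact/fg/ltnW.
Qed.

Lemma eta_exp (y : R) : 0 < y -> Defs.eta y = qpow y (1 / 24) * exp (lnpoch 1 (2 * PI * y)).
Proof.
move=> y0; rewrite /Defs.eta; congr (_ * _).
rewrite -[lnpoch _ _]Rmult_1_l -(seq_lim_prod 1 y0 Rlt_0_1); congr seq_lim.
apply: functional_extensionality => N; apply: prodR_ext => n _.
by rewrite pow_1 S_INR Rplus_comm.
Qed.

Definition exponent (m : nat -> int) (d : nat) : R := IZR (int_to_Z (m d)).

Lemma exponentE (m : nat -> int) (d : nat) : exponent m d = INR (posp (m d)) - INR (negp (m d)).
Proof.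
rewrite /exponent; case: (m d) => n; first by rewrite /= -INR_IZR_INZ Rminus_0_r.
by rewrite -[posp _]/0%nat -[negp _]/n.+1 -[INR 0]/0 Rminus_0_l INR_IZR_INZ -opp_IZR.
Qed.

Lemma INR_sum (s : seq nat) (F : nat -> nat) :
  INR (\sum_(d <- s) F d)%nat = \big[Rplus/0]_(d <- s) INR (F d).
Proof. by elim: s => [|d s IH]; rewrite ?big_nil // !big_cons plus_INR IH. Qed.

(** Applied with w(d) the indicator of p | ad for the multiplicities, and with w(d) = d for the
    rank. *)
Lemma exponent_balance (m : nat -> int) (s : seq nat) (k : nat) (w : nat -> nat) :
  (k + \sum_(d <- s) negp (m d) * w d = \sum_(d <- s) posp (m d) * w d)%nat ->
  INR k = \big[Rplus/0]_(d <- s) (exponent m d * INR (w d)).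
Proof.
move=> /(f_equal INR); rewrite plus_INR !INR_sum => E.
suff : \big[Rplus/0]_(d <- s) (exponent m d * INR (w d)) + \big[Rplus/0]_(d <- s) INR (negp (m d) * w d)
    = \big[Rplus/0]_(d <- s) INR (posp (m d) * w d) by lra.
rewrite -big_split; apply: eq_bigr => d _ /=; rewrite exponentE !mult_INR; ring.
Qed.

Lemma psum_big_exchange (s : seq nat) (f : nat -> nat -> R) (N : nat) :
  psum (fun j => \big[Rplus/0]_(d <- s) f d j) N = \big[Rplus/0]_(d <- s) psum (f d) N.
Proof.
elim: s => [|d s IH].
  by rewrite big_nil (@psum_ext _ (fun=> 0)) ?psum_const ?Rmult_0_r // => n _; rewrite big_nil.
rewrite big_cons -IH -psum_plus; apply: psum_ext => n _; exact: big_cons.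
Qed.

(** With p = e d, the condition p | (j+1) d means e | j + 1; the surviving j + 1 = e (k+1) have
    arguments (k+1)/d. *)
Lemma psum_lnpoch_dvd (p d : nat) (h : R) : (0 < p)%nat -> (d %| p)%nat -> 0 < h ->
  psum (fun j => INR (p %| j.+1 * d)%nat * lnpoch (INR j.+1 / INR p) h) p
  = lnpoch 1 (h / INR d).
Proof.
move=> p0 dp h0; have d0 := dvdn_gt0 p0 dp.
have [e E] := dvdnP dp; have e0 : (0 < e)%nat by move: p0; rewrite E muln_gt0 => /andP[].
rewrite -psum_lnpoch // E psum_mul; apply: psum_ext => k _.
case: e e0 {dp} E => // e _ E; rewrite psum_recr.
have -> : psum (fun j => INR (e.+1 * d %| (e.+1 * k + j).+1 * d)%nat
    * lnpoch (INR (e.+1 * k + j).+1 / INR (e.+1 * d)) h) e = 0.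
  rewrite (@psum_ext _ (fun=> 0)) ?psum_const ?Rmult_0_r // => j je.
  rewrite dvdn_pmul2r // -addnS dvdn_addr ?dvdn_mulr // gtnNdvd //; exact: Rmult_0_l.
rewrite dvdn_pmul2r // -addnS -mulnSr dvdn_mulr // Rplus_0_l Rmult_1_l.
have e1 := INR_gt0 (ltn0Sn e); have d1 := INR_gt0 d0.
by rewrite !mult_INR; congr lnpoch; field; lra.
Qed.

(** The denominator becomes prod_(d | p) prod_(n>=1) (1 - q^(n/d))^(m_d), an eta quotient up to a
    power of q. *)
Lemma Z_M1_exp (l p : nat) (sigma : 'M[int]_l) (xi : algC) (m : nat -> int) (y : R) :
  (2 <= p)%nat -> has_order sigma p -> fixed_point_free sigma -> primitive_root_of_unity p xi ->
  char_decomposition sigma p m -> 0 < y ->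
  Z_M1 l p (rdim sigma xi) y
  = qpow y (rho p (rdim sigma xi) - INR l / 24)
    / exp (\big[Rplus/0]_(d <- divisors p) (exponent m d * lnpoch 1 (2 * PI * y / INR d))).
Proof.
move=> p2 so fpf xip cd y0; have p0 : (0 < p)%nat := ltnW p2.
have h0 : 0 < 2 * PI * y by have := PI_RGT_0; nra.
rewrite /Z_M1; congr (_ / _).
have P0 := INR_gt0 p0.
rewrite (@prodR_ext _ (fun j => exp (INR (rdim sigma xi (p - j.+1))
  * lnpoch (INR j.+1 / INR p) (2 * PI * y)))).
  2: by move=> j _; apply: seq_lim_prod => //; apply: Rdiv_lt_0_compat => //; exact: INR_gt0.
rewrite prodR_exp; congr exp.
(* The absent index i = p may be added because its exponent is r_0 = 0; the residues then form a
   complete system. *)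
have -> : psum (fun j => INR (rdim sigma xi (p - j.+1)) * lnpoch (INR j.+1 / INR p) (2 * PI * y)) (p - 1)
  = psum (fun j => INR (rdim sigma xi (p - j.+1)) * lnpoch (INR j.+1 / INR p) (2 * PI * y)) p.
  by case: p {p2 so xip cd P0} p0 => // p _; rewrite subn1 /= subnn rdim0 // Rmult_0_l Rplus_0_r.
have rE j : (j < p)%nat -> INR (rdim sigma xi (p - j.+1))
    = \big[Rplus/0]_(d <- divisors p) (exponent m d * INR (p %| j.+1 * d)%nat).
  move=> jp; rewrite (exponent_balance (rdim_balance _ p2 so xip cd)).
  rewrite big_seq [RHS]big_seq; apply: eq_bigr => d; rewrite -dvdn_divisors // => dp.
  by rewrite mulnBl dvdn_subr // ?dvdn_mulr // leq_mul2r jp orbT.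
rewrite (@psum_ext _ (fun j => \big[Rplus/0]_(d <- divisors p)
   (exponent m d * (INR (p %| j.+1 * d)%nat * lnpoch (INR j.+1 / INR p) (2 * PI * y))))).
  2: by move=> j jp; rewrite rE // big_distrl; apply: eq_bigr => d _; exact: Rmult_assoc.
rewrite psum_big_exchange big_seq [RHS]big_seq; apply: eq_bigr => d.
by rewrite -dvdn_divisors // => dp; rewrite psum_scal psum_lnpoch_dvd.
Qed.

Lemma intRE (z : int) : intR z = intmul (GRing.one R) z.
Proof.
rewrite /intR; case: z => n /=; first by rewrite -INR_IZR_INZ INRE.
by rewrite NegzE mulrNz -pmulrn -INRE INR_IZR_INZ -RoppE -opp_IZR.
Qed.

Lemma qformR_qf (l : nat) (G : 'M[int]_l) (x : 'I_l -> R) : qformR G x = qf (map_mx intR G) x.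
Proof.
rewrite /qformR /qf Rsum_big big_enum; apply: eq_bigr => i _.
by rewrite Rsum_big big_enum; apply: eq_bigr => j _; rewrite mxE.
Qed.

Lemma detR_det (l : nat) (G : 'M[int]_l) : detR G = determinant (map_mx intR G).
Proof.
have -> : map_mx intR G = map_mx intr G by apply/matrixP => i j; rewrite !mxE intRE.
by rewrite det_map_mx /detR intRE.
Qed.

Lemma prod_over_exp_sqrt (E : R) (b : seq R) : all [pred z | Rlt_dec 0 z] b ->
  prod_over (fun z => E / sqrt z) b = E ^ size b / sqrt (prod_over id b) /\ 0 < prod_over id b.
Proof.
elim: b => [|z b IH]; first by rewrite /prod_over /= sqrt_1; split; [field | lra].
rewrite !prod_over_cons [size _]/= [all _ _]/=.
case: Rlt_dec => //= z0 /IH [-> p0]; split; last exact: Rmult_lt_0_compat.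
have s1 := sqrt_lt_R0 _ z0; have s2 := sqrt_lt_R0 _ p0.
rewrite -[id z]/z (sqrt_mult z (prod_over id b)) /=; try lra.
by field; lra.
Qed.

Lemma lim0_prod_over (f : R -> R -> R) (g : R -> R) (b : seq R) :
  all [pred z | Rlt_dec 0 z] b -> (forall z, 0 < z -> lim0 (f^~ z) (g z)) ->
  lim0 (fun t => prod_over (f t) b) (prod_over g b).
Proof.
move=> b0 fg; elim: b b0 => [|z b IH]; first by move=> _; exact: lim0_const.
by rewrite [all _ _]/=; case: Rlt_dec => //= z0 /IH; apply: lim0_mult; exact: fg.
Qed.

Lemma lim0_sqrt : lim0 sqrt 0.
Proof.
rewrite -[X in lim0 _ X]sqrt_0; apply: (@lim0_comp id sqrt 0); first by apply: continuity_pt_sqrt; lra.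
by move=> eps e0; exists eps; split=> // y hy; apply: Rabs_def1; rewrite /id; lra.
Qed.

Lemma exp_half_ln (x : R) : 0 < x -> exp (ln x / 2) = sqrt x.
Proof.
move=> x0; apply: Rsqr_inj; [exact/Rlt_le/exp_pos | exact: sqrt_pos |].
rewrite Rsqr_sqrt; last lra.
by rewrite /Rsqr -exp_plus -[RHS]exp_ln //; congr exp; field.
Qed.

(** The 2 for the two sides of the peak cancels the sqrt 4 coming from the argument 4tz of T_2. *)
Lemma sqrt_halftheta (t z : R) : 0 < t -> 0 < z ->
  sqrt t * (2 * halftheta (t * z)) = exp (defect 2 (4 * z * t)) / sqrt z.
Proof.
move=> t0 z0; have tz : 0 < t * z by nra.
have s1 := sqrt_lt_R0 _ t0; have s2 := sqrt_lt_R0 _ z0.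
rewrite /halftheta /Rminus exp_plus exp_Ropp exp_half_ln; last lra.
have -> : 4 * (t * z) = 4 * z * t by ring.
have -> : sqrt (4 * z * t) = 2 * sqrt z * sqrt t.
  have -> : 4 * z * t = 2 * 2 * (z * t) by ring.
  by rewrite (sqrt_mult (2 * 2)) ?(sqrt_mult z) ?sqrt_square; try nra; ring.
by field; lra.
Qed.

Section GaussLimits.
Variables (c2 z : R).
Hypotheses (lim2 : lim0 (defect 2) c2) (z0 : 0 < z).

Lemma lim0_exp_defect : lim0 (fun t => exp (defect 2 (4 * z * t)) / sqrt z) (exp c2 / sqrt z).
Proof.
apply: lim0_mult (lim0_const _).
apply: lim0_comp; first exact/derivable_continuous_pt/derivable_pt_exp.
by apply: lim0_rescale => //; lra.
Qed.

Lemma lim0_gauss_hi : lim0 (fun t => sqrt t * gauss_hi (t * z)) (exp c2 / sqrt z).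
Proof.
have := lim0_plus lim0_exp_defect (lim0_scal 2 lim0_sqrt); rewrite Rmult_0_r Rplus_0_r.
apply: lim0_ext => t t0; rewrite -sqrt_halftheta // /gauss_hi; ring.
Qed.

(** With V = [halftheta (t * z)], the maximum lies between 2V - 2 and 2V, which have the same limit
    after scaling by sqrt t. *)
Lemma lim0_gauss_lo : lim0 (fun t => sqrt t * gauss_lo (t * z)) (exp c2 / sqrt z).
Proof.
apply: lim0_squeeze _ _ lim0_exp_defect.
2: have := lim0_plus lim0_exp_defect (lim0_scal (-2) lim0_sqrt); rewrite Rmult_0_r Rplus_0_r; exact.
move=> t t0 /=; rewrite -sqrt_halftheta // /gauss_lo.
have s0 := sqrt_lt_R0 _ t0; have V0 : 0 < halftheta (t * z) by exact: exp_pos.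
have m1 := Rmax_r 0 (2 * halftheta (t * z) - 2).
have m2 : Rmax 0 (2 * halftheta (t * z) - 2) <= 2 * halftheta (t * z) by apply: Rmax_lub; lra.
by split; nra.
Qed.

End GaussLimits.

Lemma prod_over_pow (f : R -> R) (c : R) (b : seq R) :
  c ^ size b * prod_over f b = prod_over (fun z => c * f z) b.
Proof. by elim: b => [|z b IH]; rewrite ?prod_over_cons -?IH /prod_over /=; ring. Qed.

(** At tau = iy the term q^(<a,a>/2) is exp (-pi y <a,a>), so the bounds on box sums apply with t =
    pi y. *)
Lemma theta_lim (l : nat) (G : 'M[int]_l) (c2 : R) :
  even_lattice G -> positive_definite G -> lim0 (defect 2) c2 ->
  0 < detR G /\
  lim0 (fun y => sqrt (PI * y) ^ l * theta G y) (exp c2 ^ l / sqrt (detR G)).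
Proof.
move=> [Gs _] pG l2; have pi0 := PI_RGT_0.
pose B := map_mx intR G.
have Bs : trmx B = B by rewrite /B map_trmx Gs.
have pB : mat_posdef B by move=> x /pG; rewrite qformR_qf.
have [b [sb b0 db Hb]] := theta_bounds Bs pB.
rewrite detR_det -/B -db; have [_ d0] := prod_over_exp_sqrt 0 b0; split=> //.
have [] := prod_over_exp_sqrt (exp c2) b0; rewrite sb => <- _.
have bounds y : 0 < y -> prod_over (fun z => gauss_lo (PI * y * z)) b <= theta G y
    <= prod_over (fun z => gauss_hi (PI * y * z)) b.
  move=> y0; have [hi lo] := Hb (PI * y) ltac:(nra).
  pose F x := exp (- (PI * y * qf B x)).
  have F0 x : 0 <= F x by apply/Rlt_le/exp_pos.
  (* The box sums grow and are bounded, so the limit selected in [theta] is a genuine one. *)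
  have gr : Un_growing (fun N => boxsum N F) by move=> N; apply: boxsum_mono.
  have ub : has_ub (fun N => boxsum N F) by eexists => _ [N ->]; exact: hi.
  have [L HL] := growing_cv _ gr ub.
  have -> : theta G y = L.
    apply: seq_lim_eq; apply: (cv_ext _ HL) => N.
    rewrite -Rsum_boxsum /F; congr Rsum; apply: functional_extensionality => k.
    by rewrite /qpow qformR_qf; congr exp; rewrite /B; field.
  split; last by apply: (cv_le hi HL (cv_const _)).
  apply: Rle_plus_epsilon => eps e0; have [N0 H] := lo eps e0.
  by have := growing_ineq _ _ gr HL N0; have := H N0 (leqnn _); rewrite /F; lra.
have resc f L : lim0 f L -> lim0 (fun y => f (PI * y)) L by exact: lim0_rescale.
apply: (@lim0_squeeze (fun y => prod_over (fun z => sqrt (PI * y) * gauss_lo (PI * y * z)) b) _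
  (fun y => prod_over (fun z => sqrt (PI * y) * gauss_hi (PI * y * z)) b)).
- move=> y y0; rewrite -!prod_over_pow sb; have [h1 h2] := bounds y y0.
  by split; apply: Rmult_le_compat_l => //; apply/pow_le/sqrt_pos.
- apply: (resc (fun t => prod_over (fun z => sqrt t * gauss_lo (t * z)) b)).
  by apply: (lim0_prod_over b0) => z z0; apply: lim0_gauss_lo.
- apply: (resc (fun t => prod_over (fun z => sqrt t * gauss_hi (t * z)) b)).
  by apply: (lim0_prod_over b0) => z z0; apply: lim0_gauss_hi.
Qed.

Lemma lim0_big (s : seq nat) (f : nat -> R -> R) (L : nat -> R) :
  (forall d, d \in s -> lim0 (f d) (L d)) ->
  lim0 (fun y => \big[Rplus/0]_(d <- s) f d y) (\big[Rplus/0]_(d <- s) L d).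
Proof.
elim: s => [|d s IH] H.
  rewrite big_nil; apply: (lim0_ext _ (lim0_const 0)) => y _; by rewrite big_nil.
rewrite big_cons; apply: lim0_ext (lim0_plus (H d (mem_head _ _)) (IH _)) => [y _|e es].
  by rewrite big_cons.
by apply: H; rewrite inE es orbT.
Qed.

Lemma prod_dm_exp (p : nat) (m : nat -> int) : (0 < p)%nat ->
  prod_dm p m = exp (\big[Rplus/0]_(d <- divisors p) (exponent m d * ln (INR d))).
Proof.
move=> p0; have dv d : d \in divisors p -> (0 < d)%nat.
  by rewrite -dvdn_divisors // => /(dvdn_gt0 p0).
rewrite /prod_dm; elim: (divisors p) dv => [|d s IH] dv /=; first by rewrite big_nil exp_0.
rewrite big_cons exp_plus IH => [|e es]; last by apply: dv; rewrite inE es orbT.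
by rewrite powerRZ_Rpower //; apply/INR_gt0/dv/mem_head.
Qed.

Lemma lim0_qpow (a : R) : lim0 (fun y => qpow y a) 1.
Proof.
rewrite -exp_0 -Ropp_0 -(Rmult_0_r (2 * PI * a)).
apply: (@lim0_comp (fun y => - (2 * PI * y * a)) exp).
  exact/derivable_continuous_pt/derivable_pt_exp.
have l : lim0 id 0 by move=> eps e0; exists eps; split=> // y hy; apply: Rabs_def1; rewrite /id; lra.
have := lim0_scal (- (2 * PI * a)) l; rewrite Rmult_0_r Rmult_0_r Ropp_0.
by apply: lim0_ext => y _; rewrite /id; ring.
Qed.

(** The factor [sqrt (detR G)] is the covolume v, as G is a Gram matrix of L. *)
Theorem mainTheorem4 (l p : nat) (G sigma : 'M[int]_l) (xi : algC)
    (m : nat -> int) (dimT : nat) :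
  even_lattice G -> positive_definite G ->
  (2 <= p)%nat ->
  is_isometry G sigma -> has_order sigma p -> fixed_point_free sigma ->
  primitive_root_of_unity p xi ->
  char_decomposition sigma p m ->
  qdim_is (Z_VLT p sigma xi dimT) (Z_VL G)
    (Rdiv (Rmult (sqrt (detR G)) (INR dimT)) (sqrt (prod_dm p m))).
Proof.
move=> eG pG p2 _ so fpf xip cd; have p0 : (0 < p)%nat := ltnW p2.
have [c2 l2] := defect_lim_ex (isT : (0 < 2)%nat).
have [det0 theta_l] := theta_lim eG pG l2.
pose E := exponent m.
have dv d : d \in divisors p -> (0 < d)%nat.
  by rewrite -dvdn_divisors // => /(dvdn_gt0 p0).
have sum0 : \big[Rplus/0]_(d <- divisors p) E d = 0.
  have := exponent_balance (rdim_balance 0 p2 so xip cd); rewrite rdim0 // => E0.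
  rewrite -[RHS]/(INR 0) E0.
  by apply: eq_bigr => d _; rewrite mul0n dvdn0 Rmult_1_r.
have sumd : \big[Rplus/0]_(d <- divisors p) (E d * INR d) = INR l.
  by rewrite (exponent_balance (degree_balance p0 cd)).
(* Any coefficient u of d - 1 is turned into l u; this serves both for the limits c_d and for the
   exact expression of D. *)
have lin (u v : R) (f : nat -> R) :
  \big[Rplus/0]_(d <- divisors p) (E d * ((INR d - 1) * u + v * f d))
   = INR l * u + v * \big[Rplus/0]_(d <- divisors p) (E d * f d).
  rewrite -sumd.
  transitivity (\big[Rplus/0]_(d <- divisors p) (E d * INR d) * u
    + (\big[Rplus/0]_(d <- divisors p) E d * - u + v * \big[Rplus/0]_(d <- divisors p) (E d * f d))).
    by rewrite !big_distrl big_distrr -!big_split; apply: eq_bigr => d _ /=; ring.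
  by rewrite sum0; ring.
pose D h := \big[Rplus/0]_(d <- divisors p) (E d * defect d h).
have limD : lim0 (fun y => exp (D (2 * (PI * y))))
    (exp (INR l * (c2 + ln 2 / 2)) / sqrt (prod_dm p m)).
  have -> : exp (INR l * (c2 + ln 2 / 2)) / sqrt (prod_dm p m)
      = exp (\big[Rplus/0]_(d <- divisors p) (E d * ((INR d - 1) * (c2 + ln 2 / 2) + - / 2 * ln (INR d)))).
    rewrite lin exp_plus; congr (_ * _).
    rewrite prod_dm_exp // -exp_half_ln; last exact: exp_pos.
    by rewrite ln_exp -exp_Ropp; congr exp; rewrite /E; field.
  apply: (@lim0_comp _ exp); first exact/derivable_continuous_pt/derivable_pt_exp.
  have pi2 : 0 < 2 * PI by have := PI_RGT_0; lra.
  have := @lim0_rescale (2 * PI) D (\big[Rplus/0]_(d <- divisors p)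
    (E d * ((INR d - 1) * (c2 + ln 2 / 2) + - / 2 * ln (INR d)))) pi2.
  move=> H; apply: lim0_ext (H _) => [y _|]; first by rewrite Rmult_assoc.
  apply: lim0_big => d /dv d0; apply: lim0_scal.
  have := defect_lim d0 l2.
  by have -> : (INR d - 1) * (c2 + ln 2 / 2) - ln (INR d) / 2
    = (INR d - 1) * (c2 + ln 2 / 2) + - / 2 * ln (INR d) by field.
have s2 : 0 < sqrt 2 by apply: sqrt_lt_R0; lra.
have sdet := sqrt_lt_R0 _ det0.
have e2 : 0 < exp c2 ^ l := pow_lt _ l (exp_pos c2).
have s2l : 0 < sqrt 2 ^ l := pow_lt _ l s2.
have thl0 : exp c2 ^ l / sqrt (detR G) <> 0 by apply/not_eq_sym/Rlt_not_eq/Rdiv_lt_0_compat.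
(* The defects are taken at h = 2 pi y and theta is normalized by sqrt (pi y)^l; the factor sqrt 2^l
   accounts for the difference and cancels e^(l ln 2 / 2). *)
have lim_all := lim0_mult (lim0_mult (lim0_scal (INR dimT) (lim0_qpow (rho p (rdim sigma xi)))) limD)
   (lim0_scal (/ sqrt 2 ^ l) (lim0_inv thl0 theta_l)).
have pdm : 0 < sqrt (prod_dm p m) by apply: sqrt_lt_R0; rewrite prod_dm_exp //; exact: exp_pos.
have EQ : INR dimT * 1 * (exp (INR l * (c2 + ln 2 / 2)) / sqrt (prod_dm p m))
    * (/ sqrt 2 ^ l * / (exp c2 ^ l / sqrt (detR G)))
  = sqrt (detR G) * INR dimT / sqrt (prod_dm p m).
  have -> : exp (INR l * (c2 + ln 2 / 2)) = exp c2 ^ l * sqrt 2 ^ l.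
    rewrite -Rpow_mult_distr -exp_half_ln; last lra.
    by rewrite -exp_plus exp_pow_INR.
  by field; repeat split; lra.
rewrite EQ in lim_all.
apply: (lim0_ext _ lim_all) => y y0.
have h0 : 0 < PI * y by have := PI_RGT_0; nra.
rewrite /Z_VLT /Z_VL (Z_M1_exp p2 so fpf xip cd y0) eta_exp //.
have -> : 2 * PI * y = 2 * (PI * y) by ring.
set h := 2 * (PI * y); have hp : 0 < h by rewrite /h; lra.
have st : 0 < sqrt (PI * y) ^ l by apply/pow_lt/sqrt_lt_R0.
have -> : exp (D h) = exp (lnpoch 1 h) ^ l
    / exp (\big[Rplus/0]_(d <- divisors p) (exponent m d * lnpoch 1 (h / INR d)))
    * (sqrt 2 ^ l * sqrt (PI * y) ^ l).
  have -> : D h = \big[Rplus/0]_(d <- divisors p) (E d * ((INR d - 1) * (lnpoch 1 h + ln h / 2)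
     + 1 * (lnpoch 1 h - lnpoch 1 (h / INR d)))).
    by apply: eq_bigr => d _; rewrite /defect; field.
  rewrite lin -Rpow_mult_distr -sqrt_mult; try lra.
  rewrite -/h -exp_half_ln // !exp_pow_INR /Rdiv -exp_Ropp -!exp_plus; congr exp.
  have -> : \big[Rplus/0]_(d <- divisors p) (E d * (lnpoch 1 h - lnpoch 1 (h * / INR d)))
    = \big[Rplus/0]_(d <- divisors p) E d * lnpoch 1 h
      + -1 * \big[Rplus/0]_(d <- divisors p) (exponent m d * lnpoch 1 (h * / INR d)).
    by rewrite big_distrl big_distrr -big_split; apply: eq_bigr => d _; rewrite /E /=; ring.
  by rewrite sum0; field.
rewrite Rpow_mult_distr.
(* The factor q^(-l/24) of the twisted character cancels the prefactor of eta^l, so only q^rho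
   remains. *)
have -> : qpow y (rho p (rdim sigma xi))
    = qpow y (rho p (rdim sigma xi) - INR l / 24) * qpow y (1 / 24) ^ l.
  have -> : qpow y (1 / 24) ^ l = qpow y (INR l / 24).
    by rewrite /qpow exp_pow_INR; congr exp; field.
  by rewrite /qpow -exp_plus; congr exp; field.
rewrite !Rinv_mult /Rdiv !Rinv_mult !Rinv_inv.
have f1 : sqrt 2 ^ l * / sqrt 2 ^ l = 1 by apply: Rinv_r; lra.
have f2 : sqrt (PI * y) ^ l * / sqrt (PI * y) ^ l = 1 by apply: Rinv_r; lra.
set A := exp _ ^ l; set B := / exp _; set q := qpow y _; set r := qpow y _ ^ l.
transitivity (INR dimT * q * r * A * B * / theta G y * (sqrt 2 ^ l * / sqrt 2 ^ l)
  * (sqrt (PI * y) ^ l * / sqrt (PI * y) ^ l)); first by ring.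
by rewrite f1 f2; ring.
Qed.
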